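(* Let $d,n\in\mathbb{N}$, $r,T>0$, $\hat\alpha=(\alpha_1,\dots,\alpha_d)\in(0,1]^d$, $A,B\in\mathbb{R}^{d\times d}$, $E\in\mathbb{R}^{d\times n}$, $C=(c_{ij})\in\mathbb{R}^{n\times d}$, $D=(d_{ij})\in\mathbb{R}^{n\times n}$. Let $f:[0,T]\to\mathbb{R}^d$, $g:[0,T]\to\mathbb{R}^n$ be continuous, let $\tau_k:[0,T]\to\mathbb{R}_{\ge 0}$ ($k=1,2,3$) be continuous with $t-\tau_k(t)\ge -r$ for all $t\in[0,T]$, and let $\psi:[-r,0]\to\mathbb{R}^d$, $\varphi:[-r,0]\to\mathbb{R}^n$ be continuous with $C\psi(0)+D\varphi(-\tau_3(0))+g(0)=\varphi(0)$. Suppose that $$\sum_{k=1}^d|c_{ik}|<1\quad\text{and}\quad \sum_{j=1}^n|d_{ij}|<1\qquad\text{for all } i=1,\dots,n.$$ Then the initial value problem $$\begin{cases}{}^{C}D^{\hat\alpha}_{0^+}x(t)=Ax(t)+Bx(t-\tau_1(t))+Ey(t-\tau_2(t))+f(t), & t\in(0,T],\\ y(t)=Cx(t)+Dy(t-\tau_3(t))+g(t), & t\in[0,T],\\ x(t)=\psi(t),\ y(t)=\varphi(t), & t\in[-r,0],\end{cases}$$ has a unique solution $\Phi(\cdot;\psi,\varphi)=(x(\cdot;\psi,\varphi),y(\cdot;\psi,\varphi))^{\rm T}$ on $[-r,T]$.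
   Context: For $\alpha\in(0,1]$, $I^\alpha_{0^+}u(t)=\frac{1}{\Gamma(\alpha)}\int_0^t(t-s)^{\alpha-1}u(s)\,ds$ is the Riemann–Liouville fractional integral (with $I^0_{0^+}u=u$), and the Caputo fractional derivative is ${}^{C}D^{\alpha}_{0^+}u(t)=\frac{d}{dt}I^{1-\alpha}_{0^+}(u(t)-u(0))$ for $t>0$. For a multi-index $\hat\alpha=(\alpha_1,\dots,\alpha_d)$, ${}^{C}D^{\hat\alpha}_{0^+}x(t)=({}^{C}D^{\alpha_1}_{0^+}x_1(t),\dots,{}^{C}D^{\alpha_d}_{0^+}x_d(t))^{\rm T}$. A solution is a continuous function $(x,y)^{\rm T}:[-r,T]\to\mathbb{R}^{d+n}$ satisfying the two equations of the system and the initial condition on $[-r,0]$. *)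

(* Defs.v *)
From HB Require Import structures.
From mathcomp Require Import all_boot all_order all_algebra.
From mathcomp Require Import all_classical all_reals all_analysis.

Set Implicit Arguments.
Unset Strict Implicit.
Unset Printing Implicit Defensive.

Import Order.TTheory GRing.Theory Num.Theory.
Import numFieldNormedType.Exports.

Local Open Scope classical_set_scope.
Local Open Scope ring_scope.

(* Only used at arguments a > 0, where the Lebesgue integral is finite. *)
Definition Gamma_fun (R : realType) (a : R) : R :=
  \int[lebesgue_measure]_(t in `[0, +oo[) (t `^ (a - 1) * expR (- t)).

Definition RL_integral (R : realType) (a : R) (u : R -> R) (t : R) : R :=
  if a == 0 then u t
  else (Gamma_fun a)^-1 *
       \int[lebesgue_measure]_(s in `[0, t]) ((t - s) `^ (a - 1) * u s).

(* F has derivative l at t as a function on I: at an endpoint of I this is the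
   one-sided derivative, and values of F outside I play no role. *)
Definition is_derive_on (R : realType) (I : set R) (F : R -> R) (t l : R) :
    Prop :=
  (F s - F t) / (s - t) @[s --> within I t^'] --> l.

(* The Caputo derivative of order a of u : [0, T] -> R exists at t and equals
   l; the existence of the derivative is part of the assertion. *)
Definition is_caputo (R : realType) (T a : R) (u : R -> R) (t l : R) : Prop :=
  is_derive_on `[0, T] (RL_integral (1 - a) (fun s => u s - u 0)) t l.

Definition is_caputo_vec (R : realType) (T : R) (d : nat) (alpha : 'I_d -> R)
    (x : R -> 'cV[R]_d) (t : R) (v : 'cV[R]_d) : Prop :=
  forall i : 'I_d, is_caputo T (alpha i) (fun s => x s i 0) t (v i 0).

(* Functions on a real interval are total functions of which only the values on
   that interval matter. Phi t = (x(t), y(t))^T is a column of height d + n. *)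
Record is_solution (R : realType) (d n : nat) (r T : R) (alpha : 'I_d -> R)
    (A B : 'M[R]_d) (E : 'M[R]_(d, n)) (C : 'M[R]_(n, d)) (D : 'M[R]_n)
    (f : R -> 'cV[R]_d) (g : R -> 'cV[R]_n) (tau1 tau2 tau3 : R -> R)
    (psi : R -> 'cV[R]_d) (phi : R -> 'cV[R]_n)
    (Phi : R -> 'cV[R]_(d + n)) : Prop := IsSolution {
  sol_continuous : {within `[- r, T], continuous Phi} ;
  sol_fractional : forall t, 0 < t <= T ->
    is_caputo_vec T alpha (fun s => usubmx (Phi s)) t
      (A *m usubmx (Phi t) + B *m usubmx (Phi (t - tau1 t))
       + E *m dsubmx (Phi (t - tau2 t)) + f t) ;
  sol_algebraic : forall t, 0 <= t <= T ->
    dsubmx (Phi t) =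
      C *m usubmx (Phi t) + D *m dsubmx (Phi (t - tau3 t)) + g t ;
  sol_initial : forall t, - r <= t <= 0 ->
    usubmx (Phi t) = psi t /\ dsubmx (Phi t) = phi t
}.

(* Main.v *)
Require Import Defs.
From HB Require Import structures.
From mathcomp Require Import all_boot all_order all_algebra.
From mathcomp Require Import all_classical all_reals all_analysis.
From mathcomp Require Import ring lra measurable_realfun.

(** The fractional equations are first turned into Volterra equations. For
    [0 < a < 1] the kernels [s `^ (a - 1)] and [s `^ (- a)] have a constant
    convolution, because their product is homogeneous of degree [-1]
    ([convolution_kern]). By Tonelli, the fractional integrals of orders [a] and
    [1 - a] therefore compose to a positive multiple of ordinary integration
    ([abel_comp]). With the fundamental theorem of calculus this shows that, for
    continuous [h] and [u], the Caputo derivative of [u] is [h] on (0, T] exactly when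
    [u t = u 0 + c * abel a h t] on [0, T], for some constant [c] depending on [a] only
    ([caputo_volterra]); the uniqueness half applies [abel_comp] a second time, to see
    that a fractional integral vanishes only on the zero function ([abel_inj0]).

    A solution thus becomes a fixed point of an operator ([picard]) on continuous
    functions which extend the initial data ([picard_fixP], [solution_fixed],
    [fixed_solution]). It is a contraction for a suitable weighted supremum norm. The
    weight [expR (l * t)] increases in time, so delayed arguments cost nothing, and for
    large [l] it makes the fractional integral small compared to the weight itself
    ([abel_expR_small]). The algebraic components receive an additional factor [rho]:
    since the rows of [D] have sums at most some [delta < 1] and those of [C] at most
    [1], a large [rho] makes the algebraic equations contract as well
    ([contracting_weight]), while its effect on the fractional equations is absorbed by
    [l]. Banach's argument in that weighted norm ([weighted_fixed_point]) concludes. *)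

Set Implicit Arguments.
Unset Strict Implicit.
Unset Printing Implicit Defensive.

Import Order.TTheory GRing.Theory Num.Theory.
Import numFieldNormedType.Exports.

Local Open Scope classical_set_scope.
Local Open Scope ring_scope.

(** * Affine changes of variable *)

Section AffineChange.
Variable R : realType.
Local Notation mu := (@lebesgue_measure R).

Lemma lebesgue_measure_affine (k b : R) (A : set R) : k != 0 -> measurable A ->
  mu A = (`|k|%:E * mu ((fun x => k * x + b)%R @^-1` A))%E.
Proof.
move=> k0 mA.
have mphi : measurable_fun [set: R] (fun x : R => k * x + b).
  by apply: measurable_funD => //; exact: measurable_funM.
pose nu0 := mscale (NngNum (normr_ge0 k))
  (pushforward mu (fun x : measurableTypeR R => (k * x + b : measurableTypeR R)%R)).
pose nu : {measure set (measurableTypeR R) -> \bar R} := nu0 mphi.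
suff -> : mu A = nu A by [].
apply: lebesgue_measure_unique => // _ [[x y]] _ <-.
rewrite /nu /nu0 /= /mscale /= /pushforward.
have [k_gt0|k_lt0] : 0 < k \/ k < 0.
  by case/lt_total/orP: k0 => ?; [right|left].
- rewrite (_ : _ @^-1` _ = `](x - b) / k, (y - b) / k]%classic); last first.
    apply/seteqP; split=> z /=; rewrite !in_itv/= ltr_pdivrMr// ler_pdivlMr//;
    lra.
  rewrite !lebesgue_measure_itv/= !lte_fin ltr_pM2r ?invr_gt0// ltrD2r.
  case: ifPn => _; last by rewrite mule0.
  rewrite -!EFinD -EFinM gtr0_norm//; congr (_%:E).
  by field; rewrite gt_eqF.
- rewrite (_ : _ @^-1` _ = `[(y - b) / k, (x - b) / k[%classic); last first.
    apply/seteqP; split=> z /=; rewrite !in_itv/= ler_ndivrMr// ltr_ndivlMr//;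
    lra.
  rewrite !lebesgue_measure_itv/= !lte_fin ltr_nM2r ?invr_lt0// ltrD2r.
  case: ifPn => _; last by rewrite mule0.
  rewrite -!EFinD -EFinM ltr0_norm//; congr (_%:E).
  by field; rewrite lt_eqF.
Qed.

Lemma ge0_integral_affine (k b : R) (f : R -> \bar R) : k != 0 ->
  measurable_fun [set: R] f -> (forall x, 0 <= f x)%E ->
  (\int[mu]_x f x = `|k|%:E * \int[mu]_x f (k * x + b)%R)%E.
Proof.
move=> k0 mf f0.
have mphi : measurable_fun [set: R] (fun x : R => k * x + b).
  by apply: measurable_funD => //; exact: measurable_funM.
pose nu0 := mscale (NngNum (normr_ge0 k))
  (pushforward mu (fun x : measurableTypeR R => (k * x + b : measurableTypeR R)%R)).
transitivity (\int[nu0 mphi]_x f x)%E.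
  apply: eq_measure_integral => A mA _ /=.
  by rewrite (@lebesgue_measure_affine k b).
rewrite ge0_integral_mscale//=.
by rewrite ge0_integral_pushforward.
Qed.

End AffineChange.

(** * The power kernel *)

Section PowerIntegral.
Variable R : realType.
Local Notation mu := (@lebesgue_measure R).

(** Away from [0] this is the fundamental theorem of calculus; the segments
    from [x / (n + 2)] to [x] exhaust the interval. *)
Lemma integral_powR (a x : R) : 0 < a -> 0 <= x ->
  (\int[mu]_(u in `]0%R, x]) (u `^ (a - 1))%R%:E = (x `^ a / a)%R%:E)%E.
Proof.
move=> a0; rewrite le_eqVlt => /predU1P[<-|x0].
  by rewrite set_itvoc0 integral_set0 powR0 ?gt_eqF// mul0r.
pose F n := `[x / n.+2%:R, x]%classic.
have Fgt0 n : 0 < x / n.+2%:R :> R by rewrite divr_gt0.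
have Flt n : x / n.+2%:R < x :> R.
  by rewrite ltr_pdivrMr// ltr_pMr// ltr1n.
have FE n : (\int[mu]_(u in F n) (u `^ (a - 1))%R%:E =
    (x `^ a / a - (x / n.+2%:R) `^ a / a)%R%:E)%E.
  have dp (y : R) : 0 < y -> is_derive y 1 (fun y : R => y `^ a / a) (y `^ (a - 1)).
    move=> y0; have h := is_derive1_powR a y0.
    have := is_deriveZ a^-1 h.
    rewrite /GRing.scale/= mulrA mulVf ?gt_eqF// mul1r.
    by congr is_derive; apply/funext => z /=; rewrite mulrC.
  rewrite /F (@continuous_FTC2 _ _ (fun y => y `^ a / a)) ?EFinB//.
  - apply/continuous_in_subspaceT => y; rewrite inE/= in_itv/= => /andP[y1 y2].
    have y0 : 0 < y by exact: lt_le_trans y1.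
    apply/differentiable_continuous/derivable1_diffP.
    by apply: derivable_powR; rewrite in_itv/= y0.
  - have cp (y : R) : 0 < y -> {for y, continuous (fun y => y `^ a / a)}.
      move=> y0; apply/differentiable_continuous/derivable1_diffP.
      by have [] := dp _ y0.
    split.
    + move=> y; rewrite in_itv/= => /andP[y1 _].
      by have [] := dp y (lt_trans (Fgt0 n) y1).
    + by apply: cvg_at_right_filter; exact: cp.
    + by apply: cvg_at_left_filter; exact: cp.
  - move=> y; rewrite in_itv/= => /andP[y1 _].
    by rewrite derive1E; have [_ ->] := dp y (lt_trans (Fgt0 n) y1).
have FU : \bigcup_n F n = `]0, x]%classic.
  apply/seteqP; split=> y /=.
    by move=> [n _]; rewrite /F/= !in_itv/= => /andP[y1 ->]; rewrite (lt_le_trans _ y1).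
  rewrite in_itv/= => /andP[y0 yx].
  exists (Num.truncn (x / y)) => //; rewrite /F/= in_itv/= yx andbT.
  rewrite ler_pdivrMr// -ler_pdivrMl// mulrC ltW//.
  apply: (lt_trans (Num.Theory.truncnS_gt _)).
  by rewrite ltr_nat.
have : (\int[mu]_(u in F n) (u `^ (a - 1))%R%:E @[n --> \oo] -->
   \int[mu]_(u in \bigcup_n F n) (u `^ (a - 1))%R%:E)%E.
  apply: ge0_nondecreasing_set_cvg_integral.
  - move=> m n mn; rewrite subsetEset => y; rewrite /F/= !in_itv/= => /andP[y1 ->].
    rewrite andbT (le_trans _ y1)// ler_pM2l// lef_pV2 ?posrE// ler_nat.
    by rewrite !ltnS.
  - by move=> i; exact: measurable_itv.
  - move=> i; apply/measurable_EFinP; apply: measurable_funTS.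
    exact: measurable_powR.
  - by move=> i y _; rewrite lee_fin powR_ge0.
rewrite FU => /cvg_lim <-//.
apply/cvg_lim => //.
under eq_fun do rewrite FE.
apply: cvg_EFin; first by near=> n.
rewrite -[X in _ --> X]subr0; apply: cvgB; first exact: cvg_cst.
rewrite -[X in _ --> X](mul0r a^-1); apply: cvgM; last exact: cvg_cst.
apply: (@cvg_comp _ _ _ _ (fun z => z `^ a) _ (0^'+) _ _ (powR_cvg0 a0)).
have h : x / n.+2%:R @[n --> \oo] --> (0 : R).
  rewrite -[X in _ --> X](mulr0 x); apply: cvgM; first exact: cvg_cst.
  have := @cvg_harmonic R; rewrite -(cvg_shiftS (@harmonic R)).
  exact.
move=> A /h hA.
have {}hA : \forall n \near \oo, 0 < x / n.+2%:R -> A (x / n.+2%:R) := hA.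
suff : \forall n \near \oo, A (x / n.+2%:R) by [].
by apply: filterS hA => n; apply; exact: Fgt0.
Unshelve. all: by end_near. Qed.


(** The convolution kernel, cut off so that it lives on the whole line: with it,
    integrals over moving intervals become integrals over [R] to which Tonelli and
    affine changes of variable apply. *)
Definition kern (a u : R) : R := if 0 < u then u `^ (a - 1) else 0.

Lemma kern_ge0 a u : 0 <= kern a u.
Proof. by rewrite /kern; case: ifP => // _; exact: powR_ge0. Qed.

Lemma kern_gt0 a u : 0 < u -> kern a u = u `^ (a - 1).
Proof. by rewrite /kern => ->. Qed.

Lemma kern_le0 a u : u <= 0 -> kern a u = 0.
Proof. by rewrite /kern leNgt => /negbTE ->. Qed.

Lemma kernM a k u : 0 < k -> kern a (k * u) = k `^ (a - 1) * kern a u.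
Proof.
move=> k0; have [u0|u0] := ltP 0 u.
  by rewrite !kern_gt0 ?mulr_gt0// powRM// ltW.
by rewrite !kern_le0 ?mulr0// pmulr_rle0.
Qed.

Lemma measurable_kern a : measurable_fun [set: R] (kern a).
Proof.
apply: measurable_fun_ifT => //.
  exact: measurable_fun_ltr.
Qed.

Lemma mem_set_ocitv (c d x : R) : (x \in `]c, d]%classic) = (c < x <= d).
Proof. by rewrite mem_setE in_itv. Qed.

Lemma mem_set_Nycitv (c x : R) : (x \in `]-oo, c]%classic) = (x <= c).
Proof. by rewrite mem_setE in_itv. Qed.

Lemma mem_set_cyitv (c x : R) : (x \in `[c, +oo[%classic) = (c <= x).
Proof. by rewrite mem_setE in_itv/= andbT. Qed.

Lemma eq_integral_restrict (A B : set R) (f g : R -> \bar R) :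
  f \_ A = g \_ B -> (\int[mu]_(x in A) f x = \int[mu]_(x in B) g x)%E.
Proof. by move=> h; rewrite integral_mkcond h -integral_mkcond. Qed.

Lemma integral_kern_left (a c : R) : 0 < a -> 0 <= c ->
  (\int[mu]_(u in `]-oo, c]) (kern a u)%:E = (c `^ a / a)%R%:E)%E.
Proof.
move=> a0 c0; rewrite -integral_powR//.
apply: eq_integral_restrict; apply/funext => u.
rewrite !patchE mem_set_ocitv mem_set_Nycitv /kern.
by case: (ltP 0 u) => u0 //=; case: ifP.
Qed.

(** Reflecting [u] to [t - s] turns the mass of the kernel near its singularity
    into the mass of [s |-> kern a (t - s)] near [t]. *)
Lemma integral_kern_shift (a c t : R) : 0 < a -> c <= t ->
  (\int[mu]_(s in `[c, +oo[) (kern a (t - s))%:E = ((t - c) `^ a / a)%R%:E)%E.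
Proof.
move=> a0 ct; rewrite -integral_kern_left ?subr_ge0//.
rewrite [RHS]integral_mkcond (@ge0_integral_affine _ (-1) t); last 3 first.
- by rewrite oppr_eq0 oner_eq0.
- apply/(measurable_restrictT _ _).1 => //; apply/measurable_EFinP/measurable_funTS.
  exact: measurable_kern.
- by move=> x; apply: erestrict_ge0 => y _; rewrite lee_fin kern_ge0.
rewrite normrN1 mul1e [LHS]integral_mkcond.
congr (integral _ _ _); apply/funext => s.
rewrite !patchE mem_set_cyitv mem_set_Nycitv mulN1r (addrC (- s)).
by rewrite lerD2l lerN2.
Qed.
End PowerIntegral.

(** * Convolution of complementary kernels *)

Section BetaConstant.
Variable R : realType.
Local Notation mu := (@lebesgue_measure R).

Lemma kern_anti (a x y : R) : a <= 1 -> 0 < x -> x <= y -> kern a y <= kern a x.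
Proof.
move=> a1 x0 xy; have y0 : 0 < y by exact: lt_le_trans xy.
rewrite !kern_gt0// -[a - 1]opprB !powRN lef_pV2 ?posrE ?powR_gt0//.
by apply: ge0_ler_powR => //; rewrite ?nnegrE ?subr_ge0// ltW.
Qed.

Lemma kern_ge1 (a x : R) : a <= 1 -> 0 < x -> x <= 1 -> 1 <= kern a x.
Proof.
move=> a1 x0 x1; rewrite -[X in X <= _](_ : kern a 1 = 1); last first.
  by rewrite kern_gt0// powR1.
exact: kern_anti.
Qed.

(** Euler's beta integral, the value of the convolution of two kernels at
    distance one. *)
Definition beta_integral (a b : R) : \bar R :=
  (\int[mu]_z (kern b (1 - z) * kern a z)%R%:E)%E.

Lemma measurable_kern_comp a (f : R -> R) : measurable_fun [set: R] f ->
  measurable_fun [set: R] (kern a \o f).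
Proof. by move=> mf; apply: measurableT_comp => //; exact: measurable_kern. Qed.

Lemma measurable_kern_sub a (t : R) :
  measurable_fun [set: R] (fun s => kern a (t - s)).
Proof. by apply: measurable_kern_comp; exact: measurable_funB. Qed.

Lemma measurable_kernM (a b s t : R) :
  measurable_fun [set: R] (fun z => kern b (t - z) * kern a (z - s)).
Proof.
apply: measurable_funM; first exact: measurable_kern_sub.
by apply: measurable_kern_comp; exact: measurable_funB.
Qed.

(** Each factor is singular at one end only, so on each half of the unit interval
    the product is at most a constant times one integrable kernel. *)
Lemma beta_integral_lty (a b : R) : 0 < a <= 1 -> 0 < b <= 1 ->
  (beta_integral a b < +oo)%E.
Proof.
move=> /andP[a0 a1] /andP[b0 b1].
pose ca := kern a 2^-1; pose cb := kern b 2^-1.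
pose f1 : R -> \bar R := (fun z => (kern a z)%:E) \_ `]-oo, 1].
pose f2 : R -> \bar R := (fun z => (kern b (1 - z))%:E) \_ `[0, +oo[.
have m1 : measurable_fun [set: R] f1.
  apply/(measurable_restrictT _ _).1 => //; apply/measurable_EFinP/measurable_funTS.
  exact: measurable_kern.
have m2 : measurable_fun [set: R] f2.
  apply/(measurable_restrictT _ _).1 => //; apply/measurable_EFinP/measurable_funTS.
  exact: measurable_kern_sub.
have f1_ge0 z : (0 <= f1 z)%E.
  by apply: erestrict_ge0 => y _; rewrite lee_fin kern_ge0.
have f2_ge0 z : (0 <= f2 z)%E.
  by apply: erestrict_ge0 => y _; rewrite lee_fin kern_ge0.
apply: (@le_lt_trans _ _ (\int[mu]_z (cb%:E * f1 z + ca%:E * f2 z))%E).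
  apply: ge0_le_integral => //.
  - by move=> z _; rewrite lee_fin mulr_ge0// kern_ge0.
  - apply/measurable_EFinP; apply: measurable_funM.
      exact: measurable_kern_sub.
    exact: measurable_kern.
  - by apply: emeasurable_funD; exact: measurable_funeM.
  - move=> z _; rewrite /f1 /f2 !patchE mem_set_cyitv mem_set_Nycitv.
    have [z0|z0] := leP z 0.
      rewrite (kern_le0 a z0) mulr0 adde_ge0// mule_ge0// ?lee_fin ?kern_ge0//;
      by case: ifP; rewrite ?lee_fin ?kern_ge0.
    rewrite (ltW z0).
    have [z1|z1] := leP z 1; last first.
      by rewrite kern_le0 ?mul0r ?mule0 ?adde0// subr_le0 ltW.
    rewrite -!EFinM -EFinD lee_fin.
    have [zh|zh] := leP z (2^-1).
      rewrite -[leLHS]addr0 lerD ?mulr_ge0 ?kern_ge0//.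
      by rewrite ler_wpM2r ?kern_ge0// kern_anti//; lra.
    rewrite -[leLHS]add0r lerD ?mulr_ge0 ?kern_ge0//.
    by rewrite mulrC ler_wpM2r ?kern_ge0// kern_anti//; lra.
rewrite ge0_integralD//; last 4 first.
- by move=> z _; rewrite mule_ge0// lee_fin kern_ge0.
- exact: measurable_funeM.
- by move=> z _; rewrite mule_ge0// lee_fin kern_ge0.
- exact: measurable_funeM.
rewrite !ge0_integralZl//; try by rewrite lee_fin kern_ge0.
rewrite -!integral_mkcond integral_kern_left// integral_kern_shift//.
by rewrite -!EFinM -EFinD ltry.
Qed.

Lemma beta_integral_ge1 (a b : R) : a <= 1 -> b <= 1 ->
  (1 <= beta_integral a b)%E.
Proof.
move=> a1 b1.
have -> : 1%E = (\int[mu]_z (\1_(`]0, 1[%classic : set R) z)%:E)%E.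
  rewrite integral_indic// setIT.
  have := @lebesgue_measure_itv R `]0, 1[; rewrite /= lte_fin ltr01.
  by rewrite -EFinD subr0 => ->.
apply: ge0_le_integral => //.
- by apply/measurable_EFinP; exact: measurable_indic.
- apply/measurable_EFinP; apply: measurable_funM.
    exact: measurable_kern_sub.
  exact: measurable_kern.
- move=> z _; rewrite lee_fin indicE.
  have [|_] := boolP (z \in _); last by rewrite mulr_ge0 ?kern_ge0.
  rewrite mem_setE in_itv/= => /andP[z0 z1].
  by rewrite -[leLHS]mulr1 ler_pM// kern_ge1//; lra.
Qed.

(** With exponents adding up to one the kernels are jointly homogeneous of degree
    [-1], which the Jacobian of the affine map sending [0, 1] to [s, t] cancels: the
    convolution does not depend on [s < t]. *)
Lemma convolution_kern (a b s t : R) : a + b = 1 ->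
  (\int[mu]_z (kern b (t - z) * kern a (z - s))%R%:E =
   if (s < t)%R then beta_integral a b else 0)%E.
Proof.
move=> ab; case: ifPn => [st|]; last first.
  rewrite -leNgt => ts; rewrite integral0_eq// => z _.
  have [tz|zt] := leP t z; first by rewrite kern_le0 ?mul0r// subr_le0.
  by rewrite (@kern_le0 _ a) ?mulr0// subr_le0 (le_trans (ltW zt)).
have ts0 : 0 < t - s by rewrite subr_gt0.
rewrite (@ge0_integral_affine _ (t - s) s); last 3 first.
- by rewrite gt_eqF.
- by apply/measurable_EFinP; exact: measurable_kernM.
- by move=> x; rewrite lee_fin mulr_ge0// kern_ge0.
rewrite -ge0_integralZl//; last 2 first.
- apply/measurable_EFinP; apply: (measurableT_comp (measurable_kernM a b s t)).
  by apply: measurable_funD => //; exact: measurable_funM.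
- by move=> x _; rewrite lee_fin mulr_ge0// kern_ge0.
apply: eq_integral => z _; rewrite -EFinM; congr (_%:E).
rewrite addrK.
have -> : t - ((t - s) * z + s) = (t - s) * (1 - z) by ring.
rewrite !kernM// gtr0_norm//.
have : (t - s) * ((t - s) `^ (b - 1) * (t - s) `^ (a - 1)) = 1.
  rewrite -powRD; last by rewrite (gt_eqF ts0) implybT.
  have -> : b - 1 + (a - 1) = -1 by rewrite -ab; ring.
  by rewrite powR_inv1 ?ltW// mulfV// gt_eqF.
move=> h; transitivity ((t - s) * ((t - s) `^ (b - 1) * (t - s) `^ (a - 1)) *
  (kern b (1 - z) * kern a z)); first by ring.
by rewrite h mul1r.
Qed.

End BetaConstant.

(** * Fractional integrals of continuous functions *)

Section AbelIntegral.
Variable R : realType.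
Local Notation mu := (@lebesgue_measure R).
Implicit Types (a b c t T M : R) (h k : R -> R).

(** The fractional integral without its normalising constant. *)
Definition abel a h t : R := \int[mu]_(s in `[0, t]) (kern a (t - s) * h s).

Lemma within_segment_measurable a b h : {within `[a, b], continuous h} ->
  measurable_fun `[a, b] h.
Proof. by move=> hc; apply: subspace_continuous_measurable_fun. Qed.

Lemma within_segment_bounded a b h : a <= b -> {within `[a, b], continuous h} ->
  exists M, forall s, a <= s <= b -> `|h s| <= M.
Proof.
move=> ab hc.
have nc : {within `[a, b], continuous (Num.norm \o h)}.
  by apply: within_continuous_comp => // x _; exact: norm_continuous.
have [c _ hM] := EVT_max ab nc.
by exists `|h c| => s sab; apply: (hM s); rewrite in_itv.
Qed.

Lemma integrable_kern_shift a c t : 0 < a <= 1 ->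
  mu.-integrable `[c, +oo[ (fun s => (kern a (t - s))%:E).
Proof.
move=> /andP[a0 a1]; have mk (D : set R) : measurable_fun D (fun s => (kern a (t - s))%:E).
  by apply/measurable_EFinP/measurable_funTS; exact: measurable_kern_sub.
apply/integrableP; split; first exact: mk.
under eq_integral do rewrite gee0_abs ?lee_fin ?kern_ge0//.
have [ct|tc] := leP c t; first by rewrite integral_kern_shift// ltry.
rewrite integral0_eq ?ltry// => s; rewrite /= in_itv/= andbT => cs.
by rewrite kern_le0// subr_le0 (le_trans (ltW tc)).
Qed.

Lemma integrable_kernM a c t T h : 0 < a <= 1 -> c <= T ->
  {within `[c, T], continuous h} ->
  mu.-integrable `[c, T] (fun s => (kern a (t - s) * h s)%:E).
Proof.
move=> a01 cT hc; have [M hM] := within_segment_bounded cT hc.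
have mh := within_segment_measurable hc.
have ig : mu.-integrable `[c, T] (fun s => M%:E * (kern a (t - s))%:E)%E.
  apply: integrableZl => //.
  apply: (integrableS _ _ _ (integrable_kern_shift c t a01)) => //.
  by move=> s /=; rewrite !in_itv/= andbT => /andP[].
apply: le_integrable ig => //.
- apply/measurable_EFinP; apply: measurable_funM => //.
  by apply: measurable_funTS; exact: measurable_kern_sub.
- move=> s; rewrite /= in_itv/= => /hM hsM.
  rewrite lee_fin !normrM [leRHS]mulrC ler_wpM2l//.
  by rewrite (le_trans hsM)// ler_norm.
Qed.

Lemma abel_widen a h t T : t <= T ->
  abel a h t = \int[mu]_(s in `[0, T]) (kern a (t - s) * h s).
Proof.
move=> tT; congr fine; apply: eq_integral_restrict; apply/funext => s.
rewrite !patchE !mem_setE !in_itv/=.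
have [s0|//] := leP 0 s; rewrite /=.
have [st|ts] := leP s t; first by rewrite (le_trans st).
by case: ifPn => // _; rewrite kern_le0 ?mul0r// subr_le0 ltW.
Qed.

Lemma within_segmentW a b c h : b <= c ->
  {within `[a, c], continuous h} -> {within `[a, b], continuous h}.
Proof.
move=> bc; apply: continuous_subspaceW => x /=; rewrite !in_itv/= => /andP[-> xb].
exact: le_trans xb bc.
Qed.

Lemma within_continuousZ (A : set R) c h :
  {within A, continuous h} -> {within A, continuous (fun s => c * h s)}.
Proof.
by move=> hc; apply: (@within_continuous_comp _ _ _ A h) => // x _; exact: mulrl_continuous.
Qed.

Section OnSegment.
Variable T : R.
Local Notation C := (fun h => {within `[0, T], continuous h}).

Lemma integrable_abel a t h : 0 < a <= 1 -> 0 <= t <= T -> C h ->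
  mu.-integrable `[0, t] (EFin \o (fun s => kern a (t - s) * h s)).
Proof.
move=> a01 /andP[t0 tT] hc; apply: integrable_kernM => //.
exact: within_segmentW hc.
Qed.

Lemma abelB a h k t : 0 < a <= 1 -> 0 <= t <= T -> C h -> C k ->
  abel a (fun s => h s - k s) t = abel a h t - abel a k t.
Proof.
move=> a01 t0T hc kc; rewrite -RintegralB//; try exact: integrable_abel.
by apply: eq_Rintegral => s _; rewrite mulrBr.
Qed.

Lemma abelD a h k t : 0 < a <= 1 -> 0 <= t <= T -> C h -> C k ->
  abel a (fun s => h s + k s) t = abel a h t + abel a k t.
Proof.
move=> a01 t0T hc kc; rewrite -RintegralD//; try exact: integrable_abel.
by apply: eq_Rintegral => s _; rewrite mulrDr.
Qed.

Lemma abelZ a c h t : 0 < a <= 1 -> 0 <= t <= T -> C h ->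
  abel a (fun s => c * h s) t = c * abel a h t.
Proof.
move=> a01 t0T hc; rewrite -RintegralZl//; try exact: integrable_abel.
by apply: eq_Rintegral => s _; rewrite mulrCA.
Qed.

Lemma le_abel a h k t : 0 < a <= 1 -> 0 <= t <= T -> C h -> C k ->
  (forall s, 0 <= s <= t -> h s <= k s) -> abel a h t <= abel a k t.
Proof.
move=> a01 t0T hc kc hk; apply: le_Rintegral => //; try exact: integrable_abel.
by move=> s; rewrite /= in_itv/= => st; rewrite ler_wpM2l ?kern_ge0// hk.
Qed.

Lemma normr_abel_le a h k t : 0 < a <= 1 -> 0 <= t <= T -> C h -> C k ->
  (forall s, 0 <= s <= t -> `|h s| <= k s) -> `|abel a h t| <= abel a k t.
Proof.
move=> a01 t0T hc kc hk; rewrite ler_norml; apply/andP; split.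
  rewrite lerNl -[leLHS]mulN1r -abelZ//; apply: le_abel => //.
    exact: within_continuousZ.
  by move=> s /hk; rewrite mulN1r; apply: le_trans; rewrite -normrN ler_norm.
by apply: le_abel => // s /hk; apply: le_trans; rewrite ler_norm.
Qed.

Lemma abel_cst1 a t : 0 < a -> 0 <= t -> abel a (fun=> 1) t = t `^ a / a.
Proof.
move=> a0 t0; rewrite -[RHS]/(fine (t `^ a / a)%:E).
rewrite -[in RHS](subr0 t) -(@integral_kern_shift _ a 0 t)//.
congr fine; apply: eq_integral_restrict; apply/funext => s.
rewrite !patchE !mem_setE !in_itv/= andbT mulr1.
have [s0|//] := leP 0 s; have [//|ts] := leP s t.
by rewrite /= kern_le0// subr_le0 ltW.
Qed.

End OnSegment.

(** Moving the singularity from [t] to [t'] decreases the kernel on [s < t] and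
    raises it only on [t <= s <= t'], by the mass [(t' - t) `^ a / a]; as the total
    mass does not decrease, twice that mass bounds the distance of the kernels. *)
Lemma kern_shift_dist a t t' : 0 < a <= 1 -> 0 <= t -> t <= t' ->
  (\int[mu]_(s in `[0%R, +oo[) `|kern a (t' - s) - kern a (t - s)|%:E <=
   (2 * ((t' - t) `^ a / a))%R%:E)%E.
Proof.
move=> /[dup] a01 /andP[a0 a1] t0 tt'; have t'0 := le_trans t0 tt'.
have mk (D : set R) (x : R) : measurable_fun D (fun s => (kern a (x - s))%:E).
  by apply/measurable_EFinP/measurable_funTS; exact: measurable_kern_sub.
(* [G] is the part of the new kernel past the old singularity. *)
pose G : R -> \bar R := (fun s => (kern a (t' - s))%:E) \_ `[t, +oo[.
have mG (D : set R) : measurable_fun D G.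
  by apply: measurable_funTS; apply/(measurable_restrictT _ _).1.
have G0 s : (0 <= G s)%E by apply: erestrict_ge0 => y _; rewrite lee_fin kern_ge0.
have mabs (D : set R) : measurable_fun D (fun s => `|kern a (t' - s) - kern a (t - s)|%:E).
  apply/measurable_EFinP/measurable_funTS; apply: measurableT_comp => //.
  by apply: measurable_funB; exact: measurable_kern_sub.
have : (\int[mu]_(s in `[0%R, +oo[)
    (`|kern a (t' - s) - kern a (t - s)|%:E + (kern a (t' - s))%:E) <=
  \int[mu]_(s in `[0%R, +oo[) ((kern a (t - s))%:E + 2%:E * G s))%E.
  apply: ge0_le_integral => //.
  - by move=> s _; rewrite adde_ge0// lee_fin ?kern_ge0.
  - by apply: emeasurable_funD; [exact: mabs|exact: mk].
  - by apply: emeasurable_funD; [exact: mk|apply: measurable_funeM; exact: mG].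
  - move=> s _; rewrite /G patchE mem_set_cyitv.
    have [ts|st] := leP t s.
      rewrite (@kern_le0 _ _ (t - s)) ?subr_le0// subr0 ger0_norm ?kern_ge0//.
      by rewrite add0e -EFinM -EFinD lee_fin -mulr2n mulr_natl.
    rewrite mule0 adde0 -EFinD lee_fin distrC ger0_norm ?subrK// subr_ge0.
    by apply: kern_anti; rewrite ?subr_gt0 ?lerD2r.
rewrite ge0_integralD; last 5 first.
- exact: measurable_itv.
- by move=> s _; rewrite lee_fin.
- exact: mabs.
- by move=> s _; rewrite lee_fin kern_ge0.
- exact: mk.
rewrite ge0_integralD; last 5 first.
- exact: measurable_itv.
- by move=> s _; rewrite lee_fin kern_ge0.
- exact: mk.
- by move=> s _; rewrite mule_ge0.
- by apply: measurable_funeM; exact: mG.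
rewrite ge0_integralZl//; last exact: mG.
rewrite -integral_mkcondr (_ : `[0%R, +oo[ `&` `[t, +oo[ = `[t, +oo[)%classic; last first.
  apply/seteqP; split=> s /=; rewrite !in_itv/= !andbT; first by case.
  by move=> ts; split => //; exact: le_trans ts.
rewrite !integral_kern_shift// !subr0 -EFinM -EFinD -leeBrDr//.
move=> /le_trans; apply; rewrite -EFinB lee_fin.
have : t `^ a / a <= t' `^ a / a.
  rewrite ler_wpM2r ?invr_ge0 ?(ltW a0)//.
  by apply: ge0_ler_powR => //; rewrite ?nnegrE// ltW.
lra.
Qed.

(** Fractional integration raises continuous functions to Hoelder continuous ones. *)
Lemma abel_holder a h T M t t' : 0 < a <= 1 -> {within `[0, T], continuous h} ->
  (forall s, 0 <= s <= T -> `|h s| <= M) -> 0 <= t -> t <= t' -> t' <= T ->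
  `|abel a h t' - abel a h t| <= M * (2 * ((t' - t) `^ a / a)).
Proof.
move=> a01 hc hM t0 tt' t'T.
have T0 : 0 <= T by rewrite (le_trans t0)// (le_trans tt').
have M0 : 0 <= M by apply: le_trans (hM 0 _) => //; rewrite lexx.
rewrite (abel_widen _ _ t'T) (abel_widen _ _ (le_trans tt' t'T)).
rewrite -RintegralB//; try exact: integrable_kernM.
have iB : mu.-integrable `[0, T]
  (EFin \o (fun s => kern a (t' - s) * h s - kern a (t - s) * h s)).
  have i1 := integrable_kernM t' a01 T0 hc; have i2 := integrable_kernM t a01 T0 hc.
  exact: (@integrableB _ _ R mu _ (measurable_itv _) _ _ i1 i2).
apply: (le_trans (le_normr_Rintegral _ iB)) => //.
rewrite -lee_fin fineK; last first.
  by apply: integrable_fin_num => //; exact: integrable_norm.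
have mk (D : set R) : measurable_fun D (fun s => `|kern a (t' - s) - kern a (t - s)|%:E).
  apply/measurable_EFinP/measurable_funTS; apply: measurableT_comp => //.
  by apply: measurable_funB; exact: measurable_kern_sub.
apply: (@le_trans _ _ (\int[mu]_(s in `[0%R, +oo[)
    (M%:E * `|kern a (t' - s) - kern a (t - s)|%:E))%E); last first.
  rewrite ge0_integralZl//; last exact: mk.
  by rewrite EFinM lee_wpmul2l ?lee_fin// kern_shift_dist.
apply: (@le_trans _ _ (\int[mu]_(s in `[0%R, T])
    (M%:E * `|kern a (t' - s) - kern a (t - s)|%:E))%E).
  apply: ge0_le_integral => //.
  - have /integrableP[/measurable_EFinP m1 _] := iB.
    by apply/measurable_EFinP; apply: measurableT_comp.
  - by apply: measurable_funeM; exact: mk.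
  - move=> s; rewrite /= in_itv/= => /hM hs; rewrite lee_fin.
    by rewrite -mulrBl normrM mulrC ler_wpM2r.
apply: ge0_subset_integral => //.
- by apply: measurable_funeM; exact: mk.
- by move=> s _; rewrite lee_fin mulr_ge0.
- by move=> s /=; rewrite !in_itv/= andbT => /andP[].
Qed.

Lemma continuous_abel a h T : 0 < a <= 1 -> 0 <= T ->
  {within `[0, T], continuous h} -> {within `[0, T], continuous (abel a h)}.
Proof.
move=> /[dup] a01 /andP[a0 _] T0 hc; have [M hM] := within_segment_bounded T0 hc.
have M0 : 0 <= M by apply: le_trans (hM 0 _) => //; rewrite lexx.
apply/subspace_continuousP => t; rewrite /= in_itv/= => /andP[t0 tT].
apply/cvgrPdist_le => e e0.
have pc : (M * (2 * (u `^ a / a))) @[u --> 0^'+] --> (0 : R).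
  rewrite -[X in _ --> X](mulr0 M) -[X in M * X](mulr0 2) -[X in 2 * X](mul0r a^-1).
  apply: cvgM; first exact: cvg_cst.
  apply: cvgM; first exact: cvg_cst.
  by apply: cvgM; [exact: powR_cvg0|exact: cvg_cst].
have /cvgrPdist_le/(_ e e0)[d /= d0 dP] := pc.
have H x y : 0 <= x -> x <= y -> y <= T -> y - x < d ->
    `|abel a h y - abel a h x| <= e.
  move=> x0 xy yT yxd; have [<-|yx] := eqVneq x y.
    by rewrite subrr normr0 ltW.
  have xy' : x < y by rewrite lt_neqAle yx.
  apply: (le_trans (abel_holder a01 hc hM x0 xy yT)).
  have := dP (y - x); rewrite /ball_/= !sub0r normrN gtr0_norm ?subr_gt0//.
  move=> /(_ yxd xy'); rewrite normrN; apply: le_trans; exact: ler_norm.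
rewrite /=; near=> s.
have /andP[s0 sT] : 0 <= s <= T.
  by near: s; apply: withinT => /= s; rewrite in_itv.
have : `|t - s| < d by near: s; apply: cvg_within; exact: nbhsx_ballx.
have [st|ts] := leP s t.
  by rewrite ger0_norm ?subr_ge0// => ?; exact: H.
by rewrite distrC gtr0_norm ?subr_gt0// distrC => ?; exact: H (ltW ts) _ _.
Unshelve. all: by end_near. Qed.

End AbelIntegral.

(** * Composition of complementary fractional integrals *)

Section AbelComposition.
Variable R : realType.
Local Notation mu := (@lebesgue_measure R).
Implicit Types (a b c t T M : R) (h k : R -> R).

(** Cutting [h] off outside the segment makes the fractional integral a convolution
    over the whole line, to which Tonelli applies. *)
Lemma EFin_abel a h t T : 0 < a <= 1 -> 0 <= t <= T ->
  {within `[0, T], continuous h} ->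
  ((abel a h t)%:E = \int[mu]_s (kern a (t - s) * (h \_ `[0, T]) s)%R%:E)%E.
Proof.
move=> a01 /[dup] t0T /andP[t0 tT] hc; rewrite /abel /Rintegral fineK; last first.
  by apply: integrable_fin_num => //; exact: integrable_abel t0T hc.
rewrite integral_mkcond; congr (integral _ _ _); apply/funext => s.
rewrite !patchE !mem_setE !in_itv/=.
have [st|ts] := leP s t.
  by rewrite (le_trans st tT); case: ifP => //= _; rewrite mulr0.
by rewrite andbF kern_le0 ?mul0r// subr_le0 ltW.
Qed.

Let abel_comp_ge0 a b h t T : 0 < a <= 1 -> 0 < b <= 1 -> a + b = 1 ->
  0 <= t <= T -> {within `[0, T], continuous h} ->
  (forall s, 0 <= s <= T -> 0 <= h s) ->
  abel b (abel a h) t =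
    fine (beta_integral a b) * \int[mu]_(s in `[0, t]) h s.
Proof.
move=> a01 b01 ab /[dup] t0T /andP[t0 tT] hc h0.
have T0 := le_trans t0 tT.
pose H := h \_ `[0, T].
have H0 s : 0 <= H s.
  by rewrite /H patchE mem_setE in_itv; case: ifP => // /h0.
have mH : measurable_fun [set: R] H.
  by apply/(measurable_restrictT _ _).1 => //; exact: within_segment_measurable.
have mh_t : measurable_fun `[0, t] h.
  by apply: within_segment_measurable; exact: within_segmentW hc.
have ac := continuous_abel a01 T0 hc.
apply: EFin_inj; rewrite (EFin_abel b01 t0T ac).
pose F (p : measurableTypeR R * measurableTypeR R) : \bar R :=
  (kern b (t - p.1) * kern a (p.1 - p.2) * H p.2)%:E.
have F0 p : (0 <= F p)%E by rewrite lee_fin !mulr_ge0// kern_ge0.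
have mF : measurable_fun [set: measurableTypeR R * measurableTypeR R] F.
  apply/measurable_EFinP; apply: measurable_funM; last first.
    exact: (measurableT_comp mH measurable_snd).
  by apply: measurable_funM; apply: (measurableT_comp (measurable_kern _)); exact: measurable_funB.
transitivity (\int[mu]_z \int[mu]_s F (z, s))%E.
  apply: eq_integral => z _.
  have [|zT] := boolP (z \in `[0, T]%classic); last first.
    rewrite patchE (negbTE zT) mulr0 integral0_eq// => s _; rewrite /F/= /H patchE.
    move: zT; rewrite !mem_setE !in_itv/= negb_and -!ltNge => /orP[z0|Tz].
      case: ifPn => [/andP[s0 _]|]; last by rewrite mulr0.
      by rewrite (@kern_le0 _ a) ?mulr0 ?mul0r// subr_le0 (le_trans (ltW z0)).
    by rewrite kern_le0 ?mul0r// subr_le0 (le_trans tT) ?ltW.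
  move=> zT; rewrite patchE zT; move: zT; rewrite mem_setE in_itv/= => zT.
  rewrite EFinM (EFin_abel a01 zT hc) -ge0_integralZl//; last 3 first.
  - apply/measurable_EFinP; apply: measurable_funM => //.
    exact: measurable_kern_sub.
  - by move=> s _; rewrite lee_fin mulr_ge0// kern_ge0.
  - by rewrite lee_fin kern_ge0.
  by apply: eq_integral => s _; rewrite -EFinM mulrA.
transitivity (\int[mu]_s \int[mu]_z F (z, s))%E.
  exact: (fubini_tonelli F mF F0).
transitivity (\int[mu]_s (beta_integral a b * ((h \_ `[0, t[) s)%:E))%E.
  apply: eq_integral => s _.
  transitivity ((H s)%:E * \int[mu]_z (kern b (t - z) * kern a (z - s))%R%:E)%E.
    rewrite -ge0_integralZl//; last 3 first.
    - by apply/measurable_EFinP; exact: measurable_kernM.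
    - by move=> z _; rewrite lee_fin mulr_ge0// kern_ge0.
    - by rewrite lee_fin.
    by apply: eq_integral => z _; rewrite -EFinM mulrC.
  rewrite convolution_kern// /H !patchE !mem_setE !in_itv/=.
  have [s0|] := leP 0 s; rewrite /= ?mul0e ?mule0//.
  have [st|] := ltP s t; rewrite /= ?mule0//.
  by rewrite (le_trans (ltW st) tT) muleC.
have Kfin : (beta_integral a b \is a fin_num)%E.
  rewrite ge0_fin_numE; first exact: beta_integral_lty.
  apply: le_trans (beta_integral_ge1 _ _); first by rewrite lee_fin.
    by case/andP: a01.
  by case/andP: b01.
rewrite ge0_integralZl//; last 3 first.
- apply/measurable_EFinP; apply/(measurable_restrictT _ _).1 => //.
  by apply: measurable_funS mh_t => // s /=; rewrite !in_itv/= => /andP[-> /ltW].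
- move=> s _; rewrite lee_fin patchE mem_setE in_itv/=.
  by case: ifPn => // /andP[s0 st]; apply: h0; rewrite s0 (le_trans (ltW st) tT).
- apply: le_trans (beta_integral_ge1 _ _); first by rewrite lee_fin.
    by case/andP: a01.
  by case/andP: b01.
have ih : mu.-integrable `[0, t] (EFin \o h).
  apply: continuous_compact_integrable; first exact: segment_compact.
  exact: within_segmentW hc.
rewrite -Rintegral_itv_bndo_bndc; last first.
  by apply: integrableS ih => // s /=; rewrite !in_itv/= => /andP[-> /ltW].
rewrite EFinM fineK//; congr (_ * _)%E.
rewrite /Rintegral fineK.
  by rewrite [RHS]integral_mkcond restrict_EFin.
apply: integrable_fin_num => //.
by apply: integrableS ih => // s /=; rewrite !in_itv/= => /andP[-> /ltW].
Qed.

(** Fractional integrations of complementary orders compose to ordinary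
    integration: by Tonelli the inner integral is a convolution of the two kernels,
    which is constant. Adding a constant reduces to the nonnegative case. *)
Lemma abel_comp a b h t T : 0 < a <= 1 -> 0 < b <= 1 -> a + b = 1 ->
  0 <= t <= T -> {within `[0, T], continuous h} ->
  abel b (abel a h) t =
    fine (beta_integral a b) * \int[mu]_(s in `[0, t]) h s.
Proof.
move=> a01 b01 ab /[dup] t0T /andP[t0 tT] hc; have T0 := le_trans t0 tT.
have [M hM] := within_segment_bounded T0 hc.
have M0 : 0 <= M by apply: le_trans (hM 0 _) => //; rewrite lexx.
have Mc : {within `[0, T], continuous (fun=> M)}.
  by apply: continuous_subspaceT; exact: cst_continuous.
have hMc : {within `[0, T], continuous (fun s => h s + M)} by exact: within_continuousD.
have hM0 s : 0 <= s <= T -> 0 <= h s + M by move=> /hM; rewrite ler_norml; lra.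
have Eh := @abel_comp_ge0 a b (fun s => h s + M) t T a01 b01 ab t0T hMc hM0.
have EM := @abel_comp_ge0 a b (fun=> M) t T a01 b01 ab t0T Mc (fun _ _ => M0).
have aD : abel b (abel a (fun s => h s + M)) t =
    abel b (abel a h) t + abel b (abel a (fun=> M)) t.
  rewrite -(abelD b01 t0T); try exact: continuous_abel.
  apply: eq_Rintegral => s; rewrite inE/= in_itv/= => /andP[s0 st].
  by rewrite (@abelD _ T)// s0 (le_trans st tT).
rewrite -[LHS](addrK (abel b (abel a (fun=> M)) t)) -aD Eh EM.
rewrite RintegralD//; first by ring.
  apply: continuous_compact_integrable; first exact: segment_compact.
  exact: within_segmentW hc.
apply: continuous_compact_integrable; first exact: segment_compact.
exact: within_segmentW Mc.
Qed.
End AbelComposition.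

(** * Clamping to a segment *)

Section Clamp.
Variable R : realType.
Implicit Types (a b t : R).

Definition clamp a b t : R := Num.max a (Num.min b t).

Lemma clamp_itv a b t : a <= b -> a <= clamp a b t <= b.
Proof. by move=> ab; rewrite /clamp le_max lexx/= ge_max ab ge_min lexx. Qed.

Lemma clamp_id a b t : a <= t <= b -> clamp a b t = t.
Proof. by move=> /andP[at_ tb]; rewrite /clamp min_r// max_r. Qed.

Lemma clamp_le a b t : t <= a -> a <= b -> clamp a b t = a.
Proof. by move=> ta ab; rewrite /clamp min_r ?max_l// (le_trans ta). Qed.

Lemma clamp_ge a b t : b <= t -> a <= b -> clamp a b t = b.
Proof. by move=> bt ab; rewrite /clamp min_l// max_r. Qed.

Lemma clamp_mono a b : {homo clamp a b : s t / s <= t}.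
Proof.
move=> s t st; rewrite /clamp ge_max !le_max lexx/=.
by rewrite le_min !ge_min lexx st !orbT.
Qed.

Lemma clamp_clamp a b a' b' t : a' <= a -> a <= b -> b <= b' ->
  clamp a b (clamp a' b' t) = clamp a b t.
Proof.
move=> aa ab bb; have ab' : a' <= b' by rewrite (le_trans aa)// (le_trans ab).
have [ta|/ltW ta] := leP t a'.
  by rewrite (@clamp_le a')// !(@clamp_le a)// (le_trans ta).
have [bt|/ltW tb] := leP b' t; last by rewrite (@clamp_id a')// ta.
by rewrite (@clamp_ge a')// !(@clamp_ge a)// (le_trans bb).
Qed.

Lemma continuous_clamp a b : continuous (clamp a b).
Proof.
apply: (@max_fun_continuous _ _ _ (fun=> a) (Num.min b)); first exact: cst_continuous.
apply: (@min_fun_continuous _ _ _ (fun=> b) id); first exact: cst_continuous.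
by move=> x; exact: cvg_id.
Qed.

Lemma continuous_comp_clamp (U : topologicalType) a b (f : R -> U) : a <= b ->
  {within `[a, b], continuous f} -> continuous (f \o clamp a b).
Proof.
move=> ab /subspace_continuousP fc t.
have ct : `[a, b]%classic (clamp a b t) by rewrite /= in_itv/= clamp_itv.
apply: (@cvg_comp _ _ _ (clamp a b) f _ _ _ _ (fc _ ct)) => A /=.
rewrite /within/= => hA.
have {}hA : \forall s \near t, `[a, b]%classic (clamp a b s) -> A (clamp a b s).
  exact: (@continuous_clamp a b t _ hA).
suff : \forall s \near t, A (clamp a b s) by [].
by apply: filterS hA => s; apply; rewrite /= in_itv/= clamp_itv.
Qed.

Lemma within_comp_clamp (U : topologicalType) a b (f : R -> U) :
  continuous (f \o clamp a b) -> {within `[a, b], continuous f}.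
Proof.
move=> fc; apply/subspace_continuousP => t; rewrite /= in_itv/= => tab.
apply: (@cvg_trans _ ((f \o clamp a b) x @[x --> within `[a, b] (nbhs t)])).
  have wab : within `[a, b] (nbhs t) `[a, b]%classic by exact: withinT.
  apply: near_eq_cvg; apply: filterS wab => x; rewrite /= in_itv/= => xab.
  by rewrite clamp_id.
have := fc t; rewrite /continuous_at /= (clamp_id tab); apply: cvg_trans.
by apply: cvg_app; exact: cvg_within.
Qed.

End Clamp.

(** * Derivatives and primitives on a segment *)

Section DerivativeOnSegment.
Variable R : realType.
Local Notation mu := (@lebesgue_measure R).
Implicit Types (a b t T l : R) (h k u F G : R -> R).

Lemma is_derive_quotient F t l : is_derive t 1 F l <->
  (F s - F t) / (s - t) @[s --> t^'] --> l.
Proof.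
rewrite is_derive1_caratheodory; split=> [[g [gE gc <-]]|Fl].
  have /continuous_withinNx := gc; apply: cvg_trans; apply: near_eq_cvg.
  near=> s; rewrite gE mulfK// subr_eq0; near: s; exact: nbhs_dnbhs_neq.
exists (fun s => if s == t then l else (F s - F t) / (s - t)); split.
- move=> z; case: eqVneq => [->|zt]; first by rewrite !subrr mulr0.
  by rewrite divfK// subr_eq0.
- apply/continuous_withinNx; rewrite eqxx; apply: cvg_trans Fl.
  apply: near_eq_cvg; near=> s; rewrite ifF//; apply/negbTE.
  near: s; exact: nbhs_dnbhs_neq.
- by rewrite eqxx.
Unshelve. all: by end_near. Qed.

Lemma is_derive_is_derive_on (I : set R) F t l :
  is_derive t 1 F l -> is_derive_on I F t l.
Proof.
move=> /is_derive_quotient; apply: cvg_trans; apply: cvg_app.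
exact: cvg_within.
Qed.

Lemma is_derive_on_interior T F t l : 0 < t < T ->
  is_derive_on `[0, T] F t l -> is_derive t 1 F l.
Proof.
move=> t0T Fl; apply/is_derive_quotient; apply: cvg_trans Fl; apply: cvg_app.
move=> A; rewrite /within/= => hA.
suff : \forall s \near t^', A s by [].
near=> s; have : `[0, T]%classic s -> A s by near: s.
apply; near: s; apply: nbhs_dnbhs.
apply: (@filterS _ _ _ `]0, T[%classic); last exact: near_in_itvoo.
exact: subset_itv_oo_cc.
Unshelve. all: by end_near. Qed.

Lemma is_derive_on_unique T F t l1 l2 : 0 < t <= T ->
  is_derive_on `[0, T] F t l1 -> is_derive_on `[0, T] F t l2 -> l1 = l2.
Proof.
move=> /andP[t0 tT].
(* Left neighbourhoods serve also at [t = T], where the right ones are cut off. *)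
have left_sub l : is_derive_on `[0, T] F t l ->
    (F s - F t) / (s - t) @[s --> t^'-] --> l.
  apply: cvg_trans; apply: cvg_app => A; rewrite /within/= => hA.
  suff : \forall s \near t, s < t -> A s by [].
  have {}hA : \forall s \near t, s != t -> `[0, T]%classic s -> A s by [].
  near=> s => st.
  have : s != t -> `[0, T]%classic s -> A s by near: s.
  apply; first by rewrite lt_eqF.
  rewrite /= in_itv/= (le_trans (ltW st) tT) andbT.
  by apply: ltW; near: s; exact: lt_nbhsr.
by move=> /left_sub h1 /left_sub h2; exact: (cvg_unique _ h1 h2).
Unshelve. all: by end_near. Qed.

Lemma eq_is_derive_on (I : set R) F G t l : I t -> (forall s, I s -> F s = G s) ->
  is_derive_on I F t l -> is_derive_on I G t l.
Proof.
move=> It FG; apply: cvg_trans; apply: near_eq_cvg.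
have wI : within I t^' I by exact: withinT.
by apply: filterS wI => s Is; rewrite !FG.
Qed.

Lemma is_derive_on_integral T h t : 0 < t <= T -> {within `[0, T], continuous h} ->
  is_derive_on `[0, T] (fun x => \int[mu]_(s in `[0, x]) h s) t (h t).
Proof.
move=> /andP[t0 tT] hc; have T0 : 0 <= T := le_trans (ltW t0) tT.
pose k := h \o clamp 0 T.
have kc : continuous k by exact: continuous_comp_clamp.
have kE s : 0 <= s <= T -> k s = h s by move=> sT; rewrite /k/= clamp_id.
have -> : h t = k t by rewrite kE// ltW.
apply: (@eq_is_derive_on _ (fun x => \int[mu]_(s in `[0, x]) k s)).
- by rewrite /= in_itv/= ltW.
- move=> x; rewrite /= in_itv/= => /andP[x0 xT]; apply: eq_Rintegral => s.
  by rewrite inE/= in_itv/= => /andP[s0 sx]; rewrite kE// s0 (le_trans sx).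
have ki : mu.-integrable `[0, t + 1] (EFin \o k).
  apply: continuous_compact_integrable; first exact: segment_compact.
  exact: continuous_subspaceT.
have t1 : t < t + 1 by rewrite ltrDl.
have [] := @continuous_FTC1_closed _ k 0 t _ t1 ki t0 (kc t).
by move=> /derivableP dk; rewrite derive1E => <-; exact: is_derive_is_derive_on.
Qed.

(** Fundamental theorem of calculus, both halves, when the derivative is given on a
    segment minus its left end point. *)
Lemma primitive_onP T F h : 0 < T -> {within `[0, T], continuous h} ->
  {within `[0, T], continuous F} -> F 0 = 0 ->
  (forall t, 0 < t <= T -> is_derive_on `[0, T] F t (h t)) <->
  (forall t, 0 <= t <= T -> F t = \int[mu]_(s in `[0, t]) h s).
Proof.
move=> T0 hc Fc F0; split=> [dF t /andP[t0 tT]|FE t t0T].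
- pose P x := \int[mu]_(s in `[0, x]) h s.
  have Pc : {within `[0, T], continuous P}.
    apply: parameterized_integral_continuous; first exact: ltW.
    by apply: continuous_compact_integrable => //; exact: segment_compact.
  have P0 : P 0 = 0 by rewrite /P set_itv1 Rintegral_set1.
  have dG x : x \in `]0, t[ -> is_derive x 1 (F - P) 0.
    rewrite in_itv/= => /andP[x0 xt].
    have x0T : 0 < x < T by rewrite x0 (lt_le_trans xt).
    have x0T' : 0 < x <= T by rewrite x0 (ltW (lt_le_trans xt tT)).
    have d1 := is_derive_on_interior x0T (dF x x0T').
    have d2 := is_derive_on_interior x0T (is_derive_on_integral x0T' hc).
    have := is_deriveB d1 d2; rewrite subrr; exact.
  have Gc : {within `[0, t], continuous (F - P)}.
    by apply: (within_segmentW tT); apply: within_continuousB.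
  have [c _] := MVT_segment t0 dG Gc.
  by rewrite mul0r !fctE P0 F0 subrr subr0 => /eqP; rewrite subr_eq0 => /eqP.
- apply: (@eq_is_derive_on _ (fun x => \int[mu]_(s in `[0, x]) h s)).
  + by rewrite /= in_itv/=; case/andP: t0T => /ltW ->.
  + by move=> s; rewrite /= in_itv/= => /FE.
  exact: is_derive_on_integral.
Qed.

Lemma integral_eq0 T h : {within `[0, T], continuous h} ->
  (forall t, 0 <= t <= T -> \int[mu]_(s in `[0, t]) h s = 0) ->
  forall t, 0 < t <= T -> h t = 0.
Proof.
move=> hc h0 t t0T.
apply: (@is_derive_on_unique T (fun x => \int[mu]_(s in `[0, x]) h s) t) => //.
  exact: is_derive_on_integral.
apply: (@eq_is_derive_on _ (fun=> 0)).
- by rewrite /= in_itv/=; case/andP: t0T => /ltW ->.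
- by move=> s; rewrite /= in_itv/= => /h0.
- by apply: is_derive_is_derive_on; exact: is_derive_cst.
Qed.

End DerivativeOnSegment.

(** * Caputo equations as Volterra equations *)

Section CaputoVolterra.
Variable R : realType.
Local Notation mu := (@lebesgue_measure R).
Implicit Types (a b t T l : R) (h k u F G : R -> R).

Lemma integral_expRN : (\int[mu]_(t in `[0%R, +oo[) (expR (- t))%:E = 1)%E.
Proof.
rewrite -(@integral_exponential_pdf R 1 ltr01) integral_mkcond.
congr (integral _ _ _); apply/funext => x; rewrite /exponential_pdf !patchE.
by case: ifP => // _; rewrite mul1r mulN1r.
Qed.

(** On [0, 1] the integrand is at most the kernel and beyond it at most the
    exponential, so the integral is finite; it is positive as the integrand is at
    least [expR (- 1)] on the unit interval. *)
Lemma Gamma_fun_gt0 a : 0 < a < 1 -> 0 < Gamma_fun a.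
Proof.
move=> /andP[a0 a1]; pose f s : \bar R := (s `^ (a - 1) * expR (- s))%:E.
have mf (D : set R) : measurable_fun D f.
  apply/measurable_EFinP/measurable_funTS; apply: measurable_funM.
    exact: measurable_powR.
  by apply: measurableT_comp => //; exact: measurable_expR.
have f0 s : (0 <= f s)%E by rewrite lee_fin mulr_ge0// ?powR_ge0 ?expR_ge0.
pose f1 : R -> \bar R := (fun s => (kern a s)%:E) \_ `]-oo, 1].
have mf1 (D : set R) : measurable_fun D f1.
  apply: measurable_funTS; apply/(measurable_restrictT _ _).1 => //.
  by apply/measurable_EFinP/measurable_funTS; exact: measurable_kern.
have f10 s : (0 <= f1 s)%E by apply: erestrict_ge0 => y _; rewrite lee_fin kern_ge0.
have me (D : set R) : measurable_fun D (fun s : R => (expR (- s))%:E).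
  apply/measurable_EFinP/measurable_funTS.
  by apply: measurableT_comp => //; exact: measurable_expR.
rewrite /Gamma_fun /Rintegral; apply: fine_gt0; apply/andP; split; last first.
  apply: (@le_lt_trans _ _ (\int[mu]_(s in `[0%R, +oo[) (f1 s + (expR (- s))%:E))%E).
    apply: ge0_le_integral => //.
    - by move=> s _; exact: f0.
    - exact: mf.
    - by apply: emeasurable_funD; [exact: mf1|exact: me].
    - move=> s; rewrite /= in_itv/= andbT => s0; rewrite /f1 patchE mem_set_Nycitv.
      have [s1|s1] := leP s 1.
        rewrite -EFinD lee_fin -[leLHS]addr0 lerD ?expR_ge0//.
        have [->|sn0] := eqVneq s 0.
          by rewrite powR0 ?mul0r ?kern_ge0// subr_eq0 lt_eqF.
        have sp : 0 < s by rewrite lt_neqAle eq_sym sn0.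
        by rewrite kern_gt0// ler_piMr ?powR_ge0// -expR0 ler_expR oppr_le0.
      rewrite add0e lee_fin ler_piMl ?expR_ge0//.
      rewrite -kern_gt0 ?(lt_trans ltr01)//.
      have := @kern_anti _ a 1 s (ltW a1) ltr01 (ltW s1).
      by rewrite (@kern_gt0 _ _ 1)// powR1.
  rewrite ge0_integralD//; last 2 first.
  - exact: mf1.
  - exact: me.
  rewrite integral_expRN lte_add_pinfty ?ltry//.
  apply: (@le_lt_trans _ _ (\int[mu]_s f1 s)%E).
    apply: ge0_subset_integral => //; exact: mf1.
  by rewrite -integral_mkcond integral_kern_left// ltry.
apply: (@lt_le_trans _ _ (\int[mu]_(s in `]0%R, 1%R]) (expR (-1))%:E)%E).
  rewrite integral_cst//.
  have := @lebesgue_measure_itv R `]0, 1]; rewrite /= lte_fin ltr01 -EFinD subr0 => ->.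
  by rewrite mule1 lte_fin expR_gt0.
apply: (@le_trans _ _ (\int[mu]_(s in `]0%R, 1%R]) f s)%E).
  apply: ge0_le_integral => //.
  - exact: mf.
  - move=> s; rewrite /= in_itv/= => /andP[s0 s1]; rewrite lee_fin.
    rewrite -[leLHS]mul1r ler_pM//.
      by rewrite -kern_gt0// kern_ge1// ltW.
    by rewrite ler_expR lerN2.
apply: ge0_subset_integral => //.
- exact: mf.
- by move=> s /=; rewrite !in_itv/= andbT => /andP[/ltW].
Qed.

Lemma RL_integral_abel a u t : 0 < a < 1 ->
  RL_integral a u t = (Gamma_fun a)^-1 * abel a u t.
Proof.
move=> /andP[a0 a1]; rewrite /RL_integral gt_eqF//; congr (_ * _).
apply: eq_Rintegral => s; rewrite inE/= in_itv/= => /andP[_ st].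
congr (_ * _); rewrite /kern subr_gt0; case: ltP => // ts.
have -> : s = t by apply/eqP; rewrite eq_le st ts.
by rewrite subrr powR0// subr_eq0 lt_eqF.
Qed.

Lemma abel1 T h t : 0 <= t <= T -> {within `[0, T], continuous h} ->
  abel 1 h t = \int[mu]_(s in `[0, t]) h s.
Proof.
move=> /[dup] t0T /andP[t0 tT] hc.
have co_cc : `[0, t[ `<=` `[0, t] by move=> s /=; rewrite !in_itv/= => /andP[-> /ltW].
rewrite /abel -!Rintegral_itv_bndo_bndc.
- apply: eq_Rintegral => s; rewrite inE/= in_itv/= => /andP[_ st].
  by rewrite kern_gt0 ?subr_gt0// subrr powRr0 mul1r.
- have ih : mu.-integrable `[0, t] (EFin \o h).
    apply: continuous_compact_integrable; first exact: segment_compact.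
    exact: within_segmentW hc.
  exact: integrableS ih.
- have ik : mu.-integrable `[0, t] (EFin \o (fun s => kern 1 (t - s) * h s)).
    by apply: (integrable_abel _ t0T) => //; rewrite ltr01 lexx.
  exact: integrableS ik.
Qed.

Lemma fine_beta_integral_gt0 a b : 0 < a <= 1 -> 0 < b <= 1 ->
  0 < fine (beta_integral a b).
Proof.
move=> /[dup] a01 /andP[_ a1] /[dup] b01 /andP[_ b1]; apply: fine_gt0.
by rewrite beta_integral_lty// andbT (lt_le_trans _ (beta_integral_ge1 a1 b1)).
Qed.

Lemma abel0 a h : abel a h 0 = 0.
Proof. by rewrite /abel set_itv1 Rintegral_set1. Qed.

(** Integrating the hypothesis once more, with the complementary order, gives a
    positive multiple of the ordinary integral of [v]; if that vanishes for all upper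
    limits, so does [v]. *)
Lemma abel_inj0 a T v : 0 < a < 1 -> {within `[0, T], continuous v} ->
  (forall t, 0 <= t <= T -> abel a v t = 0) -> forall t, 0 < t <= T -> v t = 0.
Proof.
move=> /andP[a0 a1] vc v0.
have a01 : 0 < a <= 1 by rewrite a0 ltW.
have b01 : 0 < 1 - a <= 1 by rewrite subr_gt0 a1 gerBl ltW.
apply: (integral_eq0 vc) => t t0T.
have := @abel_comp _ a (1 - a) v t T a01 b01 (subrKC _ _) t0T vc.
have -> : abel (1 - a) (abel a v) t = 0.
  rewrite -[RHS](mul0r (fine (mu `[0, t]))) -Rintegral_cst//.
  apply: eq_Rintegral => s; rewrite inE/= in_itv/= => /andP[s0 st].
  by rewrite -/(abel a v s) v0 ?mulr0// s0 (le_trans st)//; case/andP: t0T.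
move=> /esym/eqP; rewrite mulf_eq0 => /orP[|/eqP//].
by rewrite gt_eqF// fine_beta_integral_gt0.
Qed.

(** The Volterra form of a Caputo equation. For [a < 1] the constant is the one for
    which the fractional integral of order [1 - a], composed with [c * abel a], is
    ordinary integration; for [a = 1] the Caputo derivative is the derivative and
    [abel 1] is ordinary integration. *)
Lemma caputo_volterra a T : 0 < a <= 1 -> 0 < T -> exists c : R, forall h u,
  {within `[0, T], continuous h} -> {within `[0, T], continuous u} ->
  (forall t, 0 < t <= T -> is_caputo T a u t (h t)) <->
  (forall t, 0 <= t <= T -> u t = u 0 + c * abel a h t).
Proof.
move=> /andP[a0]; rewrite le_eqVlt => /predU1P[->|a1] T0.
  exists 1 => h u hc uc.
  have RE s : RL_integral (1 - 1) (fun s => u s - u 0) s = u s - u 0.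
    by rewrite /RL_integral subrr eqxx.
  have vc : {within `[0, T], continuous (fun s => u s - u 0)}.
    apply: within_continuousB => //; apply: continuous_subspaceT; exact: cst_continuous.
  have v0 : u 0 - u 0 = 0 by rewrite subrr.
  have [P Q] := primitive_onP T0 hc vc v0.
  rewrite /is_caputo (_ : RL_integral _ _ = fun s => u s - u 0); last exact/funext.
  split=> [H t t0T|H].
    by rewrite mul1r (abel1 t0T hc) -(P H t t0T) addrC subrK.
  by apply: Q => t t0T; rewrite H// mul1r (abel1 t0T hc) addrAC subrr add0r.
have a01 : 0 < a <= 1 by rewrite a0 ltW.
have b01' : 0 < 1 - a < 1 by rewrite subr_gt0 a1 gtrBl.
have b01 : 0 < 1 - a <= 1 by case/andP: b01' => -> /ltW.
have G0 := Gamma_fun_gt0 b01'.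
have K0 := fine_beta_integral_gt0 a01 b01.
set Ga := Gamma_fun _ in G0; set K := fine _ in K0.
exists (Ga / K) => h u hc uc.
pose v s := u s - u 0; pose w s := Ga / K * abel a h s.
have vc : {within `[0, T], continuous v}.
  apply: within_continuousB => //; apply: continuous_subspaceT; exact: cst_continuous.
have ac := continuous_abel a01 (ltW T0) hc.
have wc : {within `[0, T], continuous w} by exact: within_continuousZ.
have bw t : 0 <= t <= T -> abel (1 - a) w t = Ga * \int[mu]_(s in `[0, t]) h s.
  move=> t0T; rewrite /w (abelZ _ b01 t0T ac).
  rewrite (abel_comp a01 b01 _ t0T hc) ?subrKC// -/K mulrA divfK//.
  by rewrite gt_eqF.
have Jc : {within `[0, T], continuous (RL_integral (1 - a) v)}.
  rewrite (_ : RL_integral _ _ = fun t => Ga^-1 * abel (1 - a) v t).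
    by apply: within_continuousZ; apply: continuous_abel => //; exact: ltW.
  by apply/funext => t; exact: RL_integral_abel.
have J0 : RL_integral (1 - a) v 0 = 0 by rewrite RL_integral_abel// abel0 mulr0.
have [P Q] := primitive_onP T0 hc Jc J0.
split=> [H t t0T|H].
- have {}H s (s0T : 0 <= s <= T) : abel (1 - a) (fun s => v s - w s) s = 0.
    rewrite (abelB b01 s0T vc wc) bw// -(P H s s0T) RL_integral_abel// -/Ga.
    by rewrite mulrA mulfV ?gt_eqF// mul1r subrr.
  have vwc : {within `[0, T], continuous (fun s => v s - w s)}.
    exact: within_continuousB.
  have vw := abel_inj0 b01' vwc H.
  have [->|tn0] := eqVneq t 0; first by rewrite abel0 mulr0 addr0.
  have /vw/eqP : 0 < t <= T by rewrite lt_neqAle eq_sym tn0.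
  by rewrite subr_eq0 /v/w subr_eq addrC => /eqP.
- apply: Q => t t0T; rewrite RL_integral_abel// -/Ga.
  rewrite (_ : abel _ v t = abel (1 - a) w t).
    by rewrite bw// mulrA mulVf ?mul1r// gt_eqF.
  apply: eq_Rintegral => s; rewrite inE/= in_itv/= => /andP[s0 st].
  have s0T : 0 <= s <= T by rewrite s0 (le_trans st)//; case/andP: t0T.
  by rewrite /v (H s s0T) addrAC subrr add0r.
Qed.

End CaputoVolterra.

(** * Fractional integrals of exponentials *)

Section ExponentialWeight.
Variable R : realType.
Implicit Types (a b t T l e : R).

(** From [expR x >= x `^ (a / 2)]: half of the integrability of the singular kernel
    is traded for decay in [l]. *)
Lemma abel_expR_le a l t : 0 < a <= 1 -> 0 < l -> 0 <= t ->
  abel a (fun s => expR (l * s)) t <=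
    l `^ (- (a / 2)) * (t `^ (a / 2) / (a / 2)) * expR (l * t).
Proof.
move=> /[dup] a01 /andP[a0 a1] l0 t0.
have a2 : 0 < a / 2 <= 1 by apply/andP; split; lra.
have ec : {within `[0, t], continuous (fun s : R => expR (l * s))}.
  apply: continuous_subspaceT => s; apply: continuous_comp; last exact: continuous_expR.
  exact: mulrl_continuous.
have oc : {within `[0, t], continuous (fun=> 1 : R)}.
  by apply: continuous_subspaceT; exact: cst_continuous.
have t0T : 0 <= t <= t by rewrite t0 lexx.
have i1 := integrable_abel a01 t0T ec.
pose c := l `^ (- (a / 2)) * expR (l * t).
have cc : {within `[0, t], continuous (fun=> c)}.
  by apply: continuous_subspaceT; exact: cst_continuous.
have i2 := integrable_abel a2 t0T cc.
have a2p : 0 < a / 2 by case/andP: a2.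
rewrite -(abel_cst1 a2p t0) mulrAC -(abelZ _ a2 t0T oc) mulr1 -/c.
apply: le_Rintegral => //.
move=> s; rewrite /= in_itv/= => /andP[s0 st].
have [ts|ts] := leP (t - s) 0; first by rewrite !kern_le0// !mul0r.
rewrite !kern_gt0// /c.
have -> : l * s = l * t + - (l * (t - s)) by ring.
rewrite expRD expRN.
have lts : 0 < l * (t - s) by rewrite mulr_gt0.
have key : (l * (t - s)) `^ (a / 2) <= expR (l * (t - s)).
  apply: (@le_trans _ _ (1 + l * (t - s))); last exact: expR_ge1Dx.
  have [l1|l1] := leP (l * (t - s)) 1.
    apply: (@le_trans _ _ 1); last by rewrite lerDl ltW.
    have e1 : (1 : R) `^ (a / 2) = 1 by rewrite powR1.
    by rewrite -[leRHS]e1 ge0_ler_powR ?nnegrE ?(ltW a2p) ?(ltW lts).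
  apply: (@le_trans _ _ (l * (t - s))); last by rewrite lerDr.
  by rewrite ler1_powR ?ltW//; lra.
have -> : (t - s) `^ (a - 1) = (t - s) `^ (a / 2 - 1) * (t - s) `^ (a / 2).
  by rewrite -powRD ?(gt_eqF ts) ?implybT//; congr (_ `^ _); field.
rewrite powRM ?(ltW l0) ?(ltW ts)// in key.
rewrite powRN; set p := (t - s) `^ (a / 2 - 1); set x := (t - s) `^ (a / 2) in key *.
set y := l `^ (a / 2) in key *; set E := expR (l * (t - s)) in key *.
have y0 : 0 < y by rewrite powR_gt0.
have E0 : 0 < E by rewrite expR_gt0.
have -> : p * x * (expR (l * t) / E) = p * expR (l * t) * (x / E) by ring.
have -> : p * (y^-1 * expR (l * t)) = p * expR (l * t) * y^-1 by ring.
rewrite ler_wpM2l ?mulr_ge0 ?powR_ge0 ?expR_ge0//.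
by rewrite ler_pdivrMr// mulrC ler_pdivlMr// mulrC.
Qed.

Lemma abel_expR_small a T e : 0 < a <= 1 -> 0 < T -> 0 < e ->
  exists2 L, 0 < L & forall l t, L <= l -> 0 <= t <= T ->
    abel a (fun s => expR (l * s)) t <= e * expR (l * t).
Proof.
move=> /[dup] a01 /andP[a0 a1] T0 e0.
have a2 : 0 < a / 2 by rewrite divr_gt0.
pose C := T `^ (a / 2) / (a / 2).
have C0 : 0 < C by rewrite divr_gt0// powR_gt0.
exists ((C / e) `^ (2 / a)); first by rewrite powR_gt0// divr_gt0.
move=> l t Ll /andP[t0 tT].
have l0 : 0 < l by apply: lt_le_trans Ll; rewrite powR_gt0// divr_gt0.
apply: (le_trans (abel_expR_le a01 l0 t0)).
rewrite ler_wpM2r ?expR_ge0// powRN mulrC ler_pdivrMr ?powR_gt0//.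
apply: (@le_trans _ _ C).
  by rewrite ler_wpM2r ?invr_ge0 ?(ltW a2)// ge0_ler_powR ?nnegrE ?(ltW a2) ?(ltW T0).
rewrite -ler_pdivrMl// mulrC.
have -> : C / e = ((C / e) `^ (2 / a)) `^ (a / 2).
  have h : 2 / a * (a / 2) = 1 by field; rewrite gt_eqF.
  by rewrite -powRrM h powRr1// divr_ge0 ?(ltW C0) ?(ltW e0).
by rewrite ge0_ler_powR ?nnegrE ?powR_ge0 ?(ltW a2) ?(ltW l0).
Qed.

End ExponentialWeight.

(** * Fixed points in a weighted supremum norm *)

Section WeightedFixedPoint.
Variables (R : realType) (S : Type) (w : S -> R) (W : R).
Hypotheses (w_ge0 : forall s, 0 <= w s) (w_le : forall s, w s <= W).
Variables (X : (S -> R) -> Prop) (F : (S -> R) -> S -> R) (q : R).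
Hypothesis q01 : 0 <= q < 1.
Hypothesis FX : forall z, X z -> X (F z).
Hypothesis X_bounded : forall z z', X z -> X z' ->
  exists2 N, 0 <= N & forall s, `|z s - z' s| <= N * w s.
Hypothesis X_closed : forall (u : nat -> S -> R) z, (forall k, X (u k)) ->
  (forall e, 0 < e -> exists k, forall s, `|z s - u k s| <= e) -> X z.
Hypothesis F_contract : forall z z' N, X z -> X z' -> 0 <= N ->
  (forall s, `|z s - z' s| <= N * w s) ->
  forall s, `|F z s - F z' s| <= q * N * w s.

Let le_geometric_eq0 (x C : R) : (forall k, `|x| <= C * q ^+ k) -> x = 0.
Proof.
move=> h; apply/eqP; rewrite -normr_le0.
have qq : `|q| < 1 by case/andP: q01 => q0 q1; rewrite ger0_norm.
have c0 : (fun=> `|x|) k @[k --> \oo] --> `|x| by exact: cvg_cst.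
apply: (ler_cvg_to c0 (@cvg_geometric R C q qq)).
by near=> k; exact: h.
Unshelve. all: by end_near. Qed.

(** Banach's fixed point theorem for functions on [S] measured in the supremum norm
    with weight [w]; [X_closed] is closedness under uniform limits. *)
Theorem weighted_fixed_point z0 : X z0 -> exists z, [/\ X z, F z =1 z &
  forall z', X z' -> F z' =1 z' -> z' =1 z].
Proof.
move=> Xz0; have /andP[q0 q1] := q01.
pose u k := iter k F z0.
have Xu k : X (u k) by elim: k => //= k; exact: FX.
have [N N0 hN] := X_bounded (Xu 1%N) (Xu 0%N).
have step k s : `|u k.+1 s - u k s| <= N * q ^+ k * w s.
  elim: k s => [|k IH] s; first by rewrite expr0 mulr1; exact: hN.
  rewrite exprS mulrCA; apply: F_contract IH s => //.
  by rewrite mulr_ge0// exprn_ge0.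
(* The sum of the geometric series of the steps bounds all later displacements. *)
pose Q := N / (1 - q).
have Q0 : 0 <= Q by rewrite divr_ge0// subr_ge0 ltW.
have QE : Q = N + Q * q by rewrite /Q; field; rewrite subr_eq0 gt_eqF.
clearbody Q.
have dist m k s : `|u (m + k)%N s - u k s| <= Q * q ^+ k * w s.
  elim: m k => [|m IH] k.
    by rewrite add0n subrr normr0 !mulr_ge0 ?exprn_ge0.
  rewrite addSnnS -(subrKA (u k.+1 s)); apply: (le_trans (ler_normD _ _)).
  apply: (le_trans (lerD (IH k.+1) (step k s))).
  by rewrite -mulrDl ler_wpM2r// [in leRHS]QE mulrDl exprS mulrA addrC.
have W0 (s : S) : 0 <= W := le_trans (w_ge0 s) (w_le s).
have small (C e : R) : 0 < e -> exists k, `|C| * q ^+ k <= e.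
  move=> e0; have qq : `|q| < 1 by rewrite ger0_norm.
  have /cvgrPdist_le/(_ e e0)[k _ /(_ k (leqnn k))] := @cvg_geometric R `|C| q qq.
  by rewrite /= sub0r normrN ger0_norm ?mulr_ge0 ?exprn_ge0// => ?; exists k.
have cu s : cvgn (fun k => u k s).
  apply/cauchy_cvgP; apply: cauchy_exP => e e0.
  have [|k hk] := small (Q * W) (e / 2); first by rewrite divr_gt0.
  exists (u k s); exists k => // m /= km.
  rewrite /ball/= distrC -(subnK km); apply: (le_lt_trans (dist _ _ _)).
  rewrite (le_lt_trans _ (_ : e / 2 < e)) ?ltr_pdivrMr ?ltr_pMr ?ltr1n//.
  apply: le_trans hk; rewrite mulrAC ler_wpM2r ?exprn_ge0//.
  by rewrite ger0_norm ?mulr_ge0 ?(W0 s)// ler_wpM2l.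
pose z s := limn (fun k => u k s).
have zu k s : `|z s - u k s| <= Q * q ^+ k * w s.
  have c1 : `|u (m + k)%N s - u k s| @[m --> \oo] --> `|z s - u k s|.
    apply: cvg_norm; apply: cvgB; last exact: cvg_cst.
    by rewrite (cvg_shiftn k (fun k => u k s)); exact: cu.
  have c2 : (fun=> Q * q ^+ k * w s) m @[m --> \oo] --> Q * q ^+ k * w s.
    exact: cvg_cst.
  apply: (ler_cvg_to c1 c2).
  by near=> m; exact: dist.
have Xz : X z.
  apply: (X_closed Xu) => e e0; have [k hk] := small (Q * W) e e0; exists k => s.
  apply: (le_trans (zu k s)); apply: le_trans hk.
  rewrite mulrAC ler_wpM2r ?exprn_ge0//.
  by rewrite ger0_norm ?mulr_ge0 ?(W0 s)// ler_wpM2l.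
have Fz : F z =1 z.
  move=> s; apply/eqP; rewrite -subr_eq0; apply/eqP.
  apply: (@le_geometric_eq0 _ (2 * (Q * w s))) => k.
  have QQ : 0 <= Q * q ^+ k by rewrite mulr_ge0// exprn_ge0.
  have h1 := F_contract Xz (Xu k) QQ (zu k) s.
  have h2 := zu k.+1 s.
  rewrite -(subrKA (u k.+1 s)); apply: (le_trans (ler_normD _ _)).
  rewrite [X in _ + X]distrC; apply: (le_trans (lerD h1 h2)).
  have -> : q * (Q * q ^+ k) * w s + Q * q ^+ k.+1 * w s =
      2 * (Q * w s) * q ^+ k * q by rewrite exprS; ring.
  by rewrite ler_piMr ?(ltW q1)// !mulr_ge0 ?exprn_ge0.
exists z; split => // z' Xz' Fz' s; have [M M0 hM] := X_bounded Xz' Xz.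
apply/eqP; rewrite -subr_eq0; apply/eqP.
apply: (@le_geometric_eq0 _ (M * w s)) => k.
suff h j s' : `|z' s' - z s'| <= M * q ^+ j * w s' by rewrite mulrAC.
elim: j s' => [|j IH] s'; first by rewrite expr0 mulr1.
rewrite -Fz' -Fz exprS mulrCA; apply: F_contract IH s' => //.
by rewrite mulr_ge0// exprn_ge0.
Unshelve. all: by end_near. Qed.

End WeightedFixedPoint.

(** * Continuity and congruence lemmas *)

Section ContinuityTools.
Variable R : realType.

Lemma within_continuous_sum (I : finType) (A : set R) (F : I -> R -> R) :
  (forall i, {within A, continuous (F i)}) ->
  {within A, continuous (fun s => \sum_i F i s)}.
Proof.
move=> Fc; elim: (index_enum I) => [|i e IH].
  by under eq_fun do rewrite big_nil; apply: continuous_subspaceT; exact: cst_continuous.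
by under eq_fun do rewrite big_cons; exact: within_continuousD.
Qed.

Lemma continuous_entry (T : topologicalType) m p (M : T -> 'M[R]_(m, p)) i j :
  continuous M -> continuous (fun t => M t i j).
Proof.
move=> Mc t; apply: (@continuous_comp _ _ _ M (fun N : 'M[R]_(m, p) => N i j)); first exact: Mc.
exact: coord_continuous.
Qed.

Lemma continuous_mx (T : topologicalType) m p (M : T -> 'M[R]_(m, p)) :
  (forall i j, continuous (fun t => M t i j)) -> continuous M.
Proof.
move=> Mc t U [P nP sPU].
suff : \forall s \near t, forall i j, P i j (M s i j).
  by apply: filterS => s h; exact: sPU.
apply: filter_forall => i; apply: filter_forall => j.
exact: (Mc i j t (P i j) (nP i j)).
Qed.

Lemma uniform_limit_continuousR (u : nat -> R -> R) (z : R -> R) :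
  (forall k, continuous (u k)) ->
  (forall e, 0 < e -> exists k, forall s, `|z s - u k s| <= e) -> continuous z.
Proof.
move=> uc uz t; apply/cvgrPdist_le => e e0.
have e3 : 0 < e / 3 by rewrite divr_gt0.
have [k hk] := uz _ e3.
have /cvgrPdist_le/(_ _ e3) := uc k t; apply: filterS => s hs.
have h1 := hk t; have h2 := hk s; rewrite distrC in h2.
rewrite -(subrKA (u k t)) (le_trans (ler_normD _ _))//.
rewrite -(subrKA (u k s) (u k t)).
have := ler_normD (u k t - u k s) (u k s - z s).
lra.
Qed.

Lemma sumM_dist (I : finType) (M x y : I -> R) (K : R) :
  (forall i, `|x i - y i| <= K) ->
  `|\sum_i M i * x i - \sum_i M i * y i| <= (\sum_i `|M i|) * K.
Proof.
move=> xy; rewrite -sumrB mulr_suml (le_trans (ler_norm_sum _ _ _))// ler_sum// => i _.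
by rewrite -mulrBr normrM ler_wpM2l.
Qed.

(** The fractional integral at [s] only sees the values on [0, s]. *)
Lemma eq_is_caputo (T a : R) (u v : R -> R) (t l : R) : 0 < t <= T ->
  (forall s, 0 <= s <= T -> u s = v s) ->
  is_caputo T a u t l -> is_caputo T a v t l.
Proof.
move=> /andP[t0 tT] uv; have T0 : 0 <= T := le_trans (ltW t0) tT.
have uv0 : u 0 = v 0 by rewrite uv// lexx.
apply: eq_is_derive_on; first by rewrite /= in_itv/= ltW.
move=> s; rewrite /= in_itv/= => /[dup] sT /andP[s0 sT'].
rewrite /RL_integral; case: ifP => _; first by rewrite uv// uv0.
congr (_ * _); apply: eq_Rintegral => x; rewrite inE/= in_itv/= => /andP[x0 xs].
by rewrite uv ?uv0// x0 (le_trans xs).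
Qed.

End ContinuityTools.

(** * The delay system as a fixed point problem *)

Section DelaySystem.
Variables (R : realType) (d n : nat) (r T : R).
Hypotheses (r_gt0 : 0 < r) (T_gt0 : 0 < T).
Variables (alpha : 'I_d -> R) (A B : 'M[R]_d) (E : 'M[R]_(d, n)) (C : 'M[R]_(n, d))
  (D : 'M[R]_n) (f : R -> 'cV[R]_d) (g : R -> 'cV[R]_n) (tau1 tau2 tau3 : R -> R)
  (psi : R -> 'cV[R]_d) (phi : R -> 'cV[R]_n).
Hypothesis alpha01 : forall i, 0 < alpha i <= 1.
Hypotheses (f_cont : {within `[0, T], continuous f})
  (g_cont : {within `[0, T], continuous g})
  (tau1_cont : {within `[0, T], continuous tau1})
  (tau2_cont : {within `[0, T], continuous tau2})
  (tau3_cont : {within `[0, T], continuous tau3})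
  (tau1_ge0 : forall t, 0 <= t <= T -> 0 <= tau1 t)
  (tau2_ge0 : forall t, 0 <= t <= T -> 0 <= tau2 t)
  (tau3_ge0 : forall t, 0 <= t <= T -> 0 <= tau3 t)
  (tau1_le : forall t, 0 <= t <= T -> - r <= t - tau1 t)
  (tau2_le : forall t, 0 <= t <= T -> - r <= t - tau2 t)
  (tau3_le : forall t, 0 <= t <= T -> - r <= t - tau3 t)
  (psi_cont : {within `[- r, 0], continuous psi})
  (phi_cont : {within `[- r, 0], continuous phi})
  (compat : C *m psi 0 + D *m phi (- tau3 0) + g 0 = phi 0).

Local Notation S := (('I_d + 'I_n) * R)%type.

Definition initial (i : 'I_d + 'I_n) (t : R) : R :=
  match i with inl k => psi t k 0 | inr j => phi t j 0 end.

Definition fractional_rhs (z : S -> R) (k : 'I_d) (s : R) : R :=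
  \sum_l A k l * z (inl l, s) + \sum_l B k l * z (inl l, s - tau1 s)
  + \sum_j E k j * z (inr j, s - tau2 s) + f s k 0.

Definition algebraic_rhs (z : S -> R) (j : 'I_n) (s : R) : R :=
  \sum_l C j l * z (inl l, s) + \sum_m D j m * z (inr m, s - tau3 s) + g s j 0.

(** The functions among which the solution is sought. Being frozen outside the segment
    from [- r] to [T], they are determined by the values that matter, and continuity on
    the segment becomes plain continuity. *)
Record admissible (z : S -> R) : Prop := Admissible {
  adm_cont : forall i, continuous (fun t => z (i, t)) ;
  adm_clamp : forall i t, z (i, t) = z (i, clamp (- r) T t) ;
  adm_initial : forall i t, - r <= t <= 0 -> z (i, t) = initial i t }.

(** [c k] is the constant of the Volterra form of the [k]-th equation. *)
Variable c : 'I_d -> R.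

(** Adding the initial function frozen after time [0] to the right-hand side frozen
    before time [0] glues the two branches into a continuous function without a case
    distinction. Before time [0] the result is the initial function, for the fractional
    components because integrals over a point vanish, for the algebraic ones by the
    compatibility condition. *)
Definition picard (z : S -> R) (p : S) : R :=
  match p with
  | (inl k, t) => psi (clamp (- r) 0 t) k 0
      + c k * abel (alpha k) (fractional_rhs z k) (clamp 0 T t)
  | (inr j, t) => phi (clamp (- r) 0 t) j 0 - phi 0 j 0
      + algebraic_rhs z j (clamp 0 T t)
  end.

Let T_ge0 : 0 <= T := ltW T_gt0.
Let Nr_le0 : - r <= 0. Proof. by rewrite oppr_le0 ltW. Qed.
Let Nr_leT : - r <= T := le_trans Nr_le0 T_ge0.

Let delayed_cont (z : S -> R) i (tau : R -> R) : continuous (fun t => z (i, t)) ->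
  {within `[0, T], continuous tau} ->
  {within `[0, T], continuous (fun s => z (i, s - tau s))}.
Proof.
move=> zc tc.
apply: (@within_continuous_comp _ _ _ _ (fun s => s - tau s) (fun t => z (i, t))).
  by move=> x _; exact: zc.
apply: within_continuousB => //; apply: continuous_subspaceT => x; exact: cvg_id.
Qed.

Lemma fractional_rhs_cont z k : (forall i, continuous (fun t => z (i, t))) ->
  {within `[0, T], continuous (fractional_rhs z k)}.
Proof.
move=> zc; apply: within_continuousD; last exact: continuous_entry.
apply: within_continuousD; last first.
  apply: within_continuous_sum => l; apply: within_continuousZ; exact: delayed_cont.
apply: within_continuousD; apply: within_continuous_sum => l; apply: within_continuousZ.
  exact: continuous_subspaceT.
exact: delayed_cont.
Qed.

Lemma algebraic_rhs_cont z k : (forall i, continuous (fun t => z (i, t))) ->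
  {within `[0, T], continuous (algebraic_rhs z k)}.
Proof.
move=> zc; apply: within_continuousD; last exact: continuous_entry.
apply: within_continuousD; apply: within_continuous_sum => l; apply: within_continuousZ.
  exact: continuous_subspaceT.
exact: delayed_cont.
Qed.

Lemma algebraic_rhs0 z j : admissible z -> algebraic_rhs z j 0 = phi 0 j 0.
Proof.
move=> zA; have t00 : 0 <= (0 : R) <= T by rewrite lexx.
rewrite -[in RHS]compat !mxE /algebraic_rhs; congr (_ + _ + _).
  by apply: eq_bigr => l _; rewrite (adm_initial zA)// Nr_le0 lexx.
apply: eq_bigr => m _; rewrite sub0r (adm_initial zA)//.
by rewrite oppr_le0 tau3_ge0// andbT -[leRHS]sub0r tau3_le.
Qed.

Lemma picard_initial z i t : admissible z -> - r <= t <= 0 ->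
  picard z (i, t) = initial i t.
Proof.
move=> zA /[dup] rt0 /andP[_ t0]; case: i => [k|j] /=;
  rewrite (clamp_id rt0) (clamp_le t0 T_ge0).
- by rewrite abel0 mulr0 addr0.
- by rewrite algebraic_rhs0// subrK.
Qed.

Lemma picard_clamp z i t : picard z (i, t) = picard z (i, clamp (- r) T t).
Proof. by case: i => [k|j] /=; rewrite !clamp_clamp. Qed.

Lemma picard_cont z i : admissible z -> continuous (fun t => picard z (i, t)).
Proof.
move=> zA; have zc := adm_cont zA.
have gluec (u v : R -> R) : {within `[- r, 0], continuous u} ->
    {within `[0, T], continuous v} ->
    continuous (fun t => u (clamp (- r) 0 t) + v (clamp 0 T t)).
  move=> uc vc t; apply: continuousD.
    exact: (continuous_comp_clamp Nr_le0 uc).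
  exact: (continuous_comp_clamp T_ge0 vc).
case: i => [k|j].
  apply: (gluec (fun s => psi s k 0) (fun s => c k * abel _ _ s)).
    exact: continuous_entry.
  apply: within_continuousZ; apply: continuous_abel => //.
  exact: fractional_rhs_cont.
apply: (gluec (fun s => phi s j 0 - phi 0 j 0) (algebraic_rhs z j)).
  apply: within_continuousB; first exact: continuous_entry.
  apply: continuous_subspaceT; exact: cst_continuous.
exact: algebraic_rhs_cont.
Qed.

Lemma picard_admissible z : admissible z -> admissible (picard z).
Proof.
move=> zA; split.
- by move=> i; exact: picard_cont.
- exact: picard_clamp.
- by move=> i t; exact: picard_initial.
Qed.

Lemma picard_fixP z : admissible z -> picard z =1 z <->
  (forall t, 0 <= t <= T ->
    (forall k, z (inl k, t) =
       z (inl k, 0) + c k * abel (alpha k) (fractional_rhs z k) t) /\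
    (forall j, z (inr j, t) = algebraic_rhs z j t)).
Proof.
move=> zA; split=> [zE t /[dup] t0T /andP[t0 tT]|zE [i t]].
  have r00 : - r <= 0 <= (0 : R) by rewrite Nr_le0 lexx.
  split=> [k|j]; rewrite -[LHS]zE /= (clamp_id t0T) (clamp_ge t0 Nr_le0).
    by rewrite (adm_initial zA).
  by rewrite subrr add0r.
rewrite picard_clamp [RHS](adm_clamp zA).
move: (clamp_itv t Nr_leT); set s := clamp (- r) T t => /andP[rs sT].
have [s0|/ltW s0] := leP s 0.
  have rs0 : - r <= s <= 0 by rewrite rs.
  by rewrite picard_initial// (adm_initial zA).
have s0T : 0 <= s <= T by rewrite s0.
have r00 : - r <= 0 <= (0 : R) by rewrite Nr_le0 lexx.
have [zl zr] := zE s s0T.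
case: i => [k|j]; rewrite ?zl ?zr/= (clamp_id s0T) (clamp_ge s0 Nr_le0).
  by rewrite (adm_initial zA).
by rewrite subrr add0r.
Qed.

Lemma admissible_bounded z i : admissible z ->
  exists2 M, 0 <= M & forall t, `|z (i, t)| <= M.
Proof.
move=> zA; have zc : {within `[- r, T], continuous (fun t => z (i, t))}.
  by apply: continuous_subspaceT; exact: adm_cont.
have [M hM] := within_segment_bounded Nr_leT zc.
exists M; first by apply: le_trans (hM (- r) _) => //; rewrite lexx.
by move=> t; rewrite (adm_clamp zA); apply: hM; exact: clamp_itv.
Qed.

Lemma admissible_closed (u : nat -> S -> R) z : (forall k, admissible (u k)) ->
  (forall e, 0 < e -> exists k, forall p, `|z p - u k p| <= e) -> admissible z.
Proof.
move=> uA uz.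
split.
- move=> i; apply: (@uniform_limit_continuousR _ (fun k t => u k (i, t))).
    by move=> k; exact: adm_cont.
  by move=> e /uz[k hk]; exists k.
- move=> i t; apply/eqP; rewrite -subr_eq0 -normr_le0; apply/ler_addgt0Pl => e e0.
  have [k hk] := uz (e / 2) ltac:(by rewrite divr_gt0).
  have h1 := hk (i, t); have h2 := hk (i, clamp (- r) T t).
  rewrite -(adm_clamp (uA k)) in h2; rewrite distrC in h2.
  have := ler_normD (z (i, t) - u k (i, t)) (u k (i, t) - z (i, clamp (- r) T t)).
  rewrite subrKA; lra.
- move=> i t rt0; apply/eqP; rewrite -subr_eq0 -normr_le0; apply/ler_addgt0Pl => e e0.
  have [k /(_ (i, t))] := uz e e0.
  by rewrite (adm_initial (uA k))// addr0.
Qed.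

(** Weights of the contraction: growth rate [l] for the Volterra part, and a relative
    weight [rho] of the algebraic components. *)
Definition weight (rho l : R) (p : S) : R :=
  (if p.1 is inl _ then 1 else rho) * expR (l * clamp 0 T p.2).

Lemma weight_bounds rho l p : 1 <= rho -> 0 < l ->
  1 <= weight rho l p <= rho * expR (l * T).
Proof.
move=> rho1 l0; have /andP[c0 cT] := clamp_itv p.2 T_ge0.
have e1 : 1 <= expR (l * clamp 0 T p.2).
  by rewrite -expR0 ler_expR mulr_ge0// ltW.
have eT : expR (l * clamp 0 T p.2) <= expR (l * T).
  by rewrite ler_expR ler_wpM2l// ltW.
have rho0 : 0 <= rho := le_trans ler01 rho1.
rewrite /weight; case: p.1 => _; apply/andP; split.
- by rewrite mul1r.
- by rewrite ler_pM ?expR_ge0.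
- by rewrite -[leLHS]mulr1 ler_pM.
- by rewrite ler_pM ?expR_ge0.
Qed.

Lemma admissible_dist rho l z z' : 1 <= rho -> 0 < l ->
  admissible z -> admissible z' ->
  exists2 N, 0 <= N & forall p, `|z p - z' p| <= N * weight rho l p.
Proof.
move=> rho1 l0 zA zA'.
have /choice[M hM] : forall i, exists M, 0 <= M /\ forall t, `|z (i, t) - z' (i, t)| <= M.
  move=> i; have [M M0 h] := admissible_bounded i zA.
  have [M' M'0 h'] := admissible_bounded i zA'.
  exists (M + M'); split; first exact: addr_ge0.
  by move=> t; apply: (le_trans (ler_normB _ _)); exact: lerD.
have M0 i : 0 <= M i by case: (hM i).
exists (\sum_i M i); first exact: sumr_ge0.
move=> [i t]; have [_ /(_ t) h] := hM i.
apply: (le_trans h); apply: (@le_trans _ _ (\sum_i M i)).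
  by rewrite (bigD1 i)//= lerDl sumr_ge0.
rewrite -[leLHS]mulr1 ler_wpM2l ?sumr_ge0//.
by have /andP[] := weight_bounds (i, t) rho1 l0.
Qed.

(** A bound on the Lipschitz constant of the right-hand side of the [k]-th
    fractional equation in the weighted norm. *)
Definition lipschitz_rhs (rho : R) (k : 'I_d) : R :=
  \sum_l `|A k l| + \sum_l `|B k l| + (\sum_j `|E k j|) * rho.

(** A delayed argument never exceeds the current one and the weight increases in
    time, so delays do not spoil the estimates. *)
Let delayed_dist rho l (z z' : S -> R) N i s (tau : R) : 0 < l -> 0 <= rho -> 0 <= N ->
  (forall p, `|z p - z' p| <= N * weight rho l p) -> 0 <= s <= T -> 0 <= tau ->
  `|z (i, s - tau) - z' (i, s - tau)| <=
    (if i is inl _ then 1 else rho) * (N * expR (l * s)).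
Proof.
move=> l0 rho0 N0 zz sT tau0; apply: (le_trans (zz _)); rewrite /weight/= mulrCA.
rewrite ler_wpM2l//; first by case: i.
rewrite ler_wpM2l// ler_expR ler_wpM2l ?(ltW l0)//.
by rewrite -[leRHS](clamp_id sT) clamp_mono// gerBl.
Qed.

Lemma fractional_rhs_dist rho l (z z' : S -> R) N k s : 0 < l -> 0 <= rho -> 0 <= N ->
  (forall p, `|z p - z' p| <= N * weight rho l p) -> 0 <= s <= T ->
  `|fractional_rhs z k s - fractional_rhs z' k s| <=
    lipschitz_rhs rho k * (N * expR (l * s)).
Proof.
move=> l0 rho0 N0 zz sT; set K := N * expR (l * s).
have h i (tau : R) (tau0 : 0 <= tau) := delayed_dist i l0 rho0 N0 zz sT tau0.
have h0 i : `|z (i, s) - z' (i, s)| <= (if i is inl _ then 1 else rho) * K.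
  by have := h i 0 (lexx _); rewrite subr0.
have hA := @sumM_dist R 'I_d (A k) (fun m => z (inl m, s)) (fun m => z' (inl m, s)) (1 * K)
  (fun m => h0 (inl m)).
have hB := @sumM_dist R 'I_d (B k) (fun m => z (inl m, s - tau1 s))
  (fun m => z' (inl m, s - tau1 s)) (1 * K) (fun m => h (inl m) _ (tau1_ge0 sT)).
have hE := @sumM_dist R 'I_n (E k) (fun m => z (inr m, s - tau2 s))
  (fun m => z' (inr m, s - tau2 s)) (rho * K) (fun m => h (inr m) _ (tau2_ge0 sT)).
rewrite mul1r in hA hB; rewrite /fractional_rhs /lipschitz_rhs.
set a := \sum_l _ in hA *; set a' := (X in `|a - X|) in hA *.
set b := (X in `|X - _|) in hB *; set b' := (X in `|b - X|) in hB *.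
set e := (X in `|X - _|) in hE *; set e' := (X in `|e - X|) in hE *.
have -> : a + b + e + f s k 0 - (a' + b' + e' + f s k 0) = (a - a') + (b - b') + (e - e').
  ring.
rewrite (le_trans (ler_normD _ _))// !mulrDl -mulrA lerD//.
by rewrite (le_trans (ler_normD _ _))// lerD.
Qed.

Lemma algebraic_rhs_dist rho l (z z' : S -> R) N j s : 0 < l -> 0 <= rho -> 0 <= N ->
  (forall p, `|z p - z' p| <= N * weight rho l p) -> 0 <= s <= T ->
  `|algebraic_rhs z j s - algebraic_rhs z' j s| <=
    (\sum_l `|C j l| + (\sum_m `|D j m|) * rho) * (N * expR (l * s)).
Proof.
move=> l0 rho0 N0 zz sT; set K := N * expR (l * s).
have h i (tau : R) (tau0 : 0 <= tau) := delayed_dist i l0 rho0 N0 zz sT tau0.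
have h0 i : `|z (i, s) - z' (i, s)| <= (if i is inl _ then 1 else rho) * K.
  by have := h i 0 (lexx _); rewrite subr0.
have hC := @sumM_dist R 'I_d (C j) (fun m => z (inl m, s)) (fun m => z' (inl m, s)) (1 * K)
  (fun m => h0 (inl m)).
have hD := @sumM_dist R 'I_n (D j) (fun m => z (inr m, s - tau3 s))
  (fun m => z' (inr m, s - tau3 s)) (rho * K) (fun m => h (inr m) _ (tau3_ge0 sT)).
rewrite mul1r in hC; rewrite /algebraic_rhs.
set a := \sum_l _ in hC *; set a' := (X in `|a - X|) in hC *.
set b := (X in `|X - _|) in hD *; set b' := (X in `|b - X|) in hD *.
have -> : a + b + g s j 0 - (a' + b' + g s j 0) = (a - a') + (b - b') by ring.
by rewrite (le_trans (ler_normD _ _))// mulrDl -mulrA lerD.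
Qed.

(** The first hypothesis on the weights absorbs the algebraic equations, the second
    one the fractional ones. *)
Lemma picard_contract rho l q z z' N : 1 <= rho -> 0 < l ->
  (forall j, \sum_m `|C j m| + (\sum_m `|D j m|) * rho <= q * rho) ->
  (forall k t, 0 <= t <= T -> `|c k| * (lipschitz_rhs rho k *
     abel (alpha k) (fun s => expR (l * s)) t) <= q * expR (l * t)) ->
  admissible z -> admissible z' -> 0 <= N ->
  (forall p, `|z p - z' p| <= N * weight rho l p) ->
  forall p, `|picard z p - picard z' p| <= q * N * weight rho l p.
Proof.
move=> rho1 l0 hrho hl zA zA' N0 zz [i t].
have rho0 : 0 <= rho := le_trans ler01 rho1.
have sT := clamp_itv t T_ge0.
have addK (x u v : R) : x + u - (x + v) = u - v by ring.
rewrite /weight/=; case: i => [k|j]/=; move: sT; set s := clamp 0 T t => sT.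
- rewrite addK -mulrBr -(abelB (alpha01 k) sT); last 2 first.
  + by apply: fractional_rhs_cont; exact: adm_cont.
  + by apply: fractional_rhs_cont; exact: adm_cont.
  rewrite normrM mul1r.
  have ec : {within `[0, T], continuous (fun s : R => expR (l * s))}.
    apply: continuous_subspaceT => x; apply: continuous_comp; last exact: continuous_expR.
    exact: mulrl_continuous.
  have h : `|abel (alpha k) (fun x => fractional_rhs z k x - fractional_rhs z' k x) s| <=
      lipschitz_rhs rho k * N * abel (alpha k) (fun x => expR (l * x)) s.
    rewrite -(abelZ _ (alpha01 k) sT ec); apply: (normr_abel_le (alpha01 k) sT).
    - by apply: within_continuousB; apply: fractional_rhs_cont; exact: adm_cont.
    - exact: within_continuousZ.
    - move=> x /andP[x0 xs]; rewrite -mulrA; apply: fractional_rhs_dist => //.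
      by rewrite x0 (le_trans xs)//; case/andP: sT.
  apply: (le_trans (ler_wpM2l (normr_ge0 _) h)).
  have perm (x y v : R) : x * (y * N * v) = N * (x * (y * v)) by ring.
  by rewrite perm [q * N]mulrC -mulrA; exact: ler_wpM2l N0 _ _ (hl k s sT).
- rewrite addK; apply: (le_trans (algebraic_rhs_dist j l0 rho0 N0 zz sT)).
  rewrite [leRHS](_ : _ = q * rho * (N * expR (l * s))); last by ring.
  by rewrite ler_wpM2r// mulr_ge0// expR_ge0.
Qed.

Definition component (v : 'cV[R]_(d + n)) (i : 'I_d + 'I_n) : R :=
  match i with inl k => usubmx v k 0 | inr j => dsubmx v j 0 end.

Definition components_of (z : S -> R) (Phi : R -> 'cV[R]_(d + n)) : Prop :=
  forall i t, - r <= t <= T -> z (i, t) = component (Phi t) i.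

Lemma fractional_rhsE z Phi k t : components_of z Phi -> 0 <= t <= T ->
  (A *m usubmx (Phi t) + B *m usubmx (Phi (t - tau1 t))
       + E *m dsubmx (Phi (t - tau2 t)) + f t) k 0 = fractional_rhs z k t.
Proof.
move=> zPhi t0T; have /andP[t0 tT] := t0T.
rewrite 3!mxE !mxE /fractional_rhs; congr (_ + _ + _ + _).
- by apply: eq_bigr => l _; rewrite zPhi// tT (le_trans Nr_le0).
- apply: eq_bigr => l _; rewrite zPhi// tau1_le//=.
  by rewrite (le_trans _ tT)// gerBl tau1_ge0.
- apply: eq_bigr => l _; rewrite zPhi// tau2_le//=.
  by rewrite (le_trans _ tT)// gerBl tau2_ge0.
Qed.

Lemma algebraic_rhsE z Phi j t : components_of z Phi -> 0 <= t <= T ->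
  (C *m usubmx (Phi t) + D *m dsubmx (Phi (t - tau3 t)) + g t) j 0 =
  algebraic_rhs z j t.
Proof.
move=> zPhi t0T; have /andP[t0 tT] := t0T.
rewrite 2!mxE !mxE /algebraic_rhs; congr (_ + _ + _).
- by apply: eq_bigr => l _; rewrite zPhi// tT (le_trans Nr_le0).
- apply: eq_bigr => l _; rewrite zPhi// tau3_le//=.
  by rewrite (le_trans _ tT)// gerBl tau3_ge0.
Qed.

Hypothesis volterra : forall k h u,
  {within `[0, T], continuous h} -> {within `[0, T], continuous u} ->
  (forall t, 0 < t <= T -> is_caputo T (alpha k) u t (h t)) <->
  (forall t, 0 <= t <= T -> u t = u 0 + c k * abel (alpha k) h t).

Local Notation solution :=
  (is_solution r T alpha A B E C D f g tau1 tau2 tau3 psi phi).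

Let in_dom t : 0 <= t <= T -> - r <= t <= T.
Proof. by move=> /andP[t0 ->]; rewrite (le_trans Nr_le0). Qed.

Lemma solution_fixed z Phi : components_of z Phi -> admissible z ->
  solution Phi -> picard z =1 z.
Proof.
move=> zPhi zA [_ Phi_frac Phi_alg _].
apply/(picard_fixP zA) => t t0T; split=> [k|j]; last first.
  rewrite zPhi ?in_dom//= -(algebraic_rhsE _ zPhi t0T).
  by rewrite [in LHS]Phi_alg.
have zc : {within `[0, T], continuous (fun s => z (inl k, s))}.
  by apply: continuous_subspaceT; exact: adm_cont.
have [to_volterra _] := @volterra k _ _ (@fractional_rhs_cont _ k (adm_cont zA)) zc.
apply: to_volterra t0T => s.
move=> /[dup] s0T /andP[s0 sT].
have s0T' : 0 <= s <= T by rewrite ltW.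
rewrite -(fractional_rhsE _ zPhi s0T').
apply: (eq_is_caputo s0T _ (Phi_frac s s0T k)) => x x0T.
by rewrite zPhi ?in_dom.
Qed.

Lemma fixed_solution z Phi : components_of z Phi -> admissible z ->
  picard z =1 z -> solution Phi.
Proof.
move=> zPhi zA /(picard_fixP zA) zE.
have zc := adm_cont zA; split.
- apply: within_comp_clamp; apply: continuous_mx => i j.
  rewrite ord1 (_ : (fun t => _) = (fun t => z (fintype.split i, t))); first exact: zc.
  apply/funext => t; rewrite (adm_clamp zA) zPhi ?clamp_itv//= /component.
  by case: (fintype.splitP i) => k ik; rewrite !mxE; congr (Phi _ _ _); exact: val_inj.
- move=> t /[dup] t0T /andP[t0 tT] k.
  have t0T' : 0 <= t <= T by rewrite ltW.
  rewrite (fractional_rhsE _ zPhi t0T').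
  apply: (@eq_is_caputo _ _ _ (fun s => z (inl k, s))) => //.
    by move=> s s0T; rewrite zPhi ?in_dom.
  have zkc : {within `[0, T], continuous (fun s => z (inl k, s))}.
    by apply: continuous_subspaceT; exact: zc.
  have [_ from_volterra] := @volterra k _ _ (@fractional_rhs_cont _ k zc) zkc.
  by apply: from_volterra t0T => s /zE[].
- move=> t t0T; apply/matrixP => j o; rewrite ord1 (algebraic_rhsE _ zPhi t0T).
  by have [_ <-] := zE t t0T; rewrite zPhi ?in_dom.
- move=> t /[dup] rt0 /andP[rt t0].
  have rtT : - r <= t <= T by rewrite rt (le_trans t0).
  split; apply/matrixP => k o; rewrite ord1.
  + by have := adm_initial zA (inl k) rt0; rewrite zPhi.
  + by have := adm_initial zA (inr k) rt0; rewrite zPhi.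
Qed.

Lemma solution_admissible Phi : solution Phi ->
  admissible (fun p => component (Phi (clamp (- r) T p.2)) p.1).
Proof.
move=> [Phic _ _ Phi0]; have Pc := continuous_comp_clamp Nr_leT Phic; split.
- case=> [k|j] /=; under eq_fun do rewrite mxE; exact: (continuous_entry Pc).
- by move=> i t /=; rewrite clamp_clamp.
- move=> i t /[dup] rt0 /andP[rt t0]; rewrite /= clamp_id ?rt ?(le_trans t0)//.
  by have [Pu Pd] := Phi0 t rt0; case: i => k /=; rewrite ?Pu ?Pd.
Qed.

Lemma initial_admissible :
  admissible (fun p => initial p.1 (clamp (- r) 0 p.2)).
Proof.
split=> [i|i t|i t rt0] /=; last by rewrite clamp_id.
- case: i => k /=.
    exact: (continuous_comp_clamp Nr_le0 (continuous_entry psi_cont)).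
  exact: (continuous_comp_clamp Nr_le0 (continuous_entry phi_cont)).
- by rewrite clamp_clamp.
Qed.

Hypotheses (C_lt1 : forall i, \sum_(k < d) `|C i k| < 1)
  (D_lt1 : forall i, \sum_(j < n) `|D i j| < 1).

(** With [delta < 1] bounding the rows of [D], weighting the algebraic components by
    [rho = 1 / (q - delta)] makes the algebraic equations contract with ratio
    [q = (1 + delta) / 2], and a fast enough growth of the weight does the same for
    the fractional ones. *)
Lemma contracting_weight : exists rho l q, [/\ 1 <= rho, 0 < l, 0 <= q < 1,
  forall j, \sum_m `|C j m| + (\sum_m `|D j m|) * rho <= q * rho &
  forall k t, 0 <= t <= T -> `|c k| * (lipschitz_rhs rho k *
    abel (alpha k) (fun s => expR (l * s)) t) <= q * expR (l * t)].
Proof.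
pose delta := \big[Num.max/0]_j \sum_m `|D j m|.
have delta1 : delta < 1 by exact: bigmax_lt.
have Ddelta j : \sum_m `|D j m| <= delta by exact: le_bigmax.
have delta0 : 0 <= delta by exact: bigmax_ge_id.
pose q := (1 + delta) / 2; pose rho := (q - delta)^-1.
have qd0 : 0 < q - delta by rewrite /q; lra.
have q0 : 0 < q by rewrite /q; lra.
have rho1 : 1 <= rho by rewrite /rho -[leLHS]invr1 lef_pV2 ?posrE// /q; lra.
have rhoE : q * rho = delta * rho + 1.
  by rewrite /rho; field; rewrite gt_eqF.
have lip0 k : 0 <= lipschitz_rhs rho k.
  by rewrite !addr_ge0 ?mulr_ge0 ?sumr_ge0// (le_trans ler01).
have /choice[L hL] : forall k, exists L, 0 < L /\ forall l t, L <= l -> 0 <= t <= T ->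
    `|c k| * (lipschitz_rhs rho k * abel (alpha k) (fun s => expR (l * s)) t)
      <= q * expR (l * t).
  move=> k; have K0 : 0 <= `|c k| * lipschitz_rhs rho k by rewrite mulr_ge0.
  have K1 : 0 < `|c k| * lipschitz_rhs rho k + 1 by rewrite ltr_wpDl.
  have [L L0 h] := abel_expR_small (alpha01 k) T_gt0 (divr_gt0 q0 K1).
  exists L; split=> // l t Ll tT; rewrite mulrA.
  apply: (le_trans (ler_wpM2l K0 (h l t Ll tT))).
  rewrite mulrA ler_wpM2r ?expR_ge0// mulrCA ler_piMr ?(ltW q0)//.
  by rewrite ler_pdivrMr// mul1r lerDl.
have L0 k : 0 <= L k by case: (hL k) => /ltW.
exists rho, (1 + \sum_k L k), q; split => //.
- by rewrite ltr_pwDl// sumr_ge0.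
- by rewrite (ltW q0)/= /q; lra.
- move=> j; rewrite rhoE addrC lerD ?(ltW (C_lt1 j))//.
  by rewrite ler_wpM2r// (le_trans ler01).
- move=> k t; have [_] := hL k; apply.
  by rewrite (bigD1 k)//= addrCA lerDl addr_ge0// sumr_ge0.
Qed.

Lemma wellposed_of_volterra : exists Phi, solution Phi /\
  forall Phi', solution Phi' -> forall t, - r <= t <= T -> Phi' t = Phi t.
Proof.
have [rho [l [q [rho1 l0 q01 hrho hl]]]] := contracting_weight.
have [z [zA Fz z_unique]] := @weighted_fixed_point R S (weight rho l) (rho * expR (l * T))
  (fun p => le_trans ler01 (andP (weight_bounds p rho1 l0)).1)
  (fun p => (andP (weight_bounds p rho1 l0)).2)
  admissible picard q q01 picard_admissible
  (fun z z' => @admissible_dist rho l z z' rho1 l0) admissible_closed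
  (fun z z' N zA zA' => @picard_contract rho l q z z' N rho1 l0 hrho hl zA zA')
  _ initial_admissible.
pose Phi t := col_mx (\col_k z (inl k, t)) (\col_j z (inr j, t)).
have zPhi : components_of z Phi.
  by case=> k t _; rewrite /= ?col_mxKu ?col_mxKd mxE.
exists Phi; split; first exact: fixed_solution zPhi zA Fz.
move=> Phi' sol t tT.
pose z' (p : S) := component (Phi' (clamp (- r) T p.2)) p.1.
have zPhi' : components_of z' Phi' by move=> i s sT; rewrite /z'/= clamp_id.
have zA' : admissible z' by exact: solution_admissible.
have zz' := z_unique _ zA' (solution_fixed zPhi' zA' sol).
rewrite -[LHS]vsubmxK -[RHS]vsubmxK; congr col_mx; apply/matrixP => k o; rewrite ord1.
- by have := zPhi' (inl k) t tT; rewrite zz' (zPhi (inl k) t tT) => /esym.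
- by have := zPhi' (inr k) t tT; rewrite zz' (zPhi (inr k) t tT) => /esym.
Qed.
End DelaySystem.

(** * Existence and uniqueness *)

Theorem theorem3p2 (R : realType) (d n : nat) (r T : R)
    (r_gt0 : 0 < r) (T_gt0 : 0 < T)
    (alpha : 'I_d -> R) (alpha01 : forall i, 0 < alpha i <= 1)
    (A B : 'M[R]_d) (E : 'M[R]_(d, n)) (C : 'M[R]_(n, d)) (D : 'M[R]_n)
    (f : R -> 'cV[R]_d) (g : R -> 'cV[R]_n)
    (f_cont : {within `[0, T], continuous f})
    (g_cont : {within `[0, T], continuous g})
    (tau1 tau2 tau3 : R -> R)
    (tau1_cont : {within `[0, T], continuous tau1})
    (tau2_cont : {within `[0, T], continuous tau2})
    (tau3_cont : {within `[0, T], continuous tau3})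
    (tau1_ge0 : forall t, 0 <= t <= T -> 0 <= tau1 t)
    (tau2_ge0 : forall t, 0 <= t <= T -> 0 <= tau2 t)
    (tau3_ge0 : forall t, 0 <= t <= T -> 0 <= tau3 t)
    (tau1_le : forall t, 0 <= t <= T -> - r <= t - tau1 t)
    (tau2_le : forall t, 0 <= t <= T -> - r <= t - tau2 t)
    (tau3_le : forall t, 0 <= t <= T -> - r <= t - tau3 t)
    (psi : R -> 'cV[R]_d) (phi : R -> 'cV[R]_n)
    (psi_cont : {within `[- r, 0], continuous psi})
    (phi_cont : {within `[- r, 0], continuous phi})
    (compat : C *m psi 0 + D *m phi (- tau3 0) + g 0 = phi 0)
    (C_lt1 : forall i, \sum_(k < d) `|C i k| < 1)
    (D_lt1 : forall i, \sum_(j < n) `|D i j| < 1) :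
  exists Phi : R -> 'cV[R]_(d + n),
    is_solution r T alpha A B E C D f g tau1 tau2 tau3 psi phi Phi /\
    forall Phi' : R -> 'cV[R]_(d + n),
      is_solution r T alpha A B E C D f g tau1 tau2 tau3 psi phi Phi' ->
      forall t, - r <= t <= T -> Phi' t = Phi t.
Proof.
have /choice[c volterra] := fun k => caputo_volterra (alpha01 k) T_gt0.
by apply: wellposed_of_volterra volterra _ _.
Qed.
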